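(* The problem BINARY $2$-REALIZATION is in $\mathsf{NP}$. Here BINARY $2$-REALIZATION is the following decision problem. Input: a finite alphabet $\Sigma$ and a function $\nu:\Sigma_2\to\mathbb{N}$, given as the vector of its values $\nu(u)$, $u\in\Sigma_2$, each encoded in binary. Question: is there a word $w\in\Sigma^*$ with $\nu=\psi_2(w)$?
   Context: $\mathbb{N}=\{0,1,2,\dots\}$. $\Sigma_2$ denotes the set of all words $u\in\Sigma^*$ of length $|u|\le 2$ (including the empty word $\varepsilon$). For words $u,w\in\Sigma^*$, $\binom{w}{u}$ is the number of occurrences of $u$ as a scattered subword of $w$, i.e. the number of sequences of positions $1\le i_1<\dots<i_{|u|}\le|w|$ with $w[i_1]\cdots w[i_{|u|}]=u$ (so $\binom{w}{\varepsilon}=1$). The $2$-profile of $w$ is the function $\psi_2(w):\Sigma_2\to\mathbb{N}$ with $(\psi_2(w))(u)=\binom{w}{u}$. The input size is $\Theta(|\Sigma_2|+\sum_{u\in\Sigma_2}\log_2(\nu(u)+1))$. *)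

(* Defs.v *)
From HB Require Import structures.
From mathcomp Require Import all_boot all_order all_algebra.

Set Implicit Arguments.
Unset Strict Implicit.
Unset Printing Implicit Defensive.

(** * Nondeterministic multi-tape Turing machines and the class NP *)

(** Tapes are infinite in both directions. [lhs] lists the cells to the left of
    the head, nearest first; [rhs] lists the scanned cell and the cells to its
    right. All the cells beyond the two lists contain [blank]. *)
Record tape (G : Type) := Tape { lhs : seq G; rhs : seq G }.

Inductive move := MoveLeft | Stay | MoveRight.

Section Tape.
Variables (G : Type) (blank : G).

Definition read (t : tape G) : G := head blank (rhs t).

Definition write (a : G) (t : tape G) : tape G :=
  Tape (lhs t) (a :: behead (rhs t)).

Definition shift (m : move) (t : tape G) : tape G :=
  match m with
  | MoveLeft => Tape (behead (lhs t)) (head blank (lhs t) :: rhs t)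
  | Stay => t
  | MoveRight => Tape (read t :: lhs t) (behead (rhs t))
  end.

End Tape.

(** The tape alphabet consists of the input symbols, finitely many work symbols,
    and the blank [None]. The tapes are numbered [0, ..., ntm_work_tapes M], and
    tape [ord0] initially carries the input. [ntm_trans q a q' b] holds when
    the machine, in state [q] and reading [a i] on tape [i], may enter state
    [q'], write [(b i).1] on tape [i] and then move its head by [(b i).2]. *)
Record ntm (A : finType) := Ntm {
  ntm_work_tapes : nat;
  ntm_work_symbol : finType;
  ntm_state : finType;
  ntm_start : ntm_state;
  ntm_accept : pred ntm_state;
  ntm_trans :
    let symbol := option (A + ntm_work_symbol) in
    ntm_state -> {ffun 'I_ntm_work_tapes.+1 -> symbol} ->
    ntm_state -> {ffun 'I_ntm_work_tapes.+1 -> symbol * move} -> bool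
}.

Section Computation.
Variables (A : finType) (M : ntm A).

Definition ntm_symbol : Type := option (A + ntm_work_symbol M).

Record config := Config {
  conf_state : ntm_state M;
  conf_tapes : {ffun 'I_(ntm_work_tapes M).+1 -> tape ntm_symbol}
}.

Definition init (x : seq A) : config :=
  Config (ntm_start M)
    [ffun i => Tape [::] (if i == ord0 then [seq Some (inl a) | a <- x] else [::])].

Definition step (c c' : config) : Prop :=
  exists b : {ffun 'I_(ntm_work_tapes M).+1 -> ntm_symbol * move},
    ntm_trans (conf_state c) [ffun i => read None (conf_tapes c i)]
              (conf_state c') b /\
    conf_tapes c' =
      [ffun i => shift None (b i).2 (write (b i).1 (conf_tapes c i))].

Fixpoint reaches (n : nat) (c c' : config) : Prop :=
  if n is m.+1 then exists2 c1, step c c1 & reaches m c1 c' else c = c'.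

Definition accepts_in (x : seq A) (n : nat) : Prop :=
  exists2 c, reaches n (init x) c & ntm_accept (conf_state c).

Definition accepts (x : seq A) : Prop := exists n, accepts_in x n.

End Computation.

(** The running time of a nondeterministic machine on an accepted input is the
    length of its shortest accepting computation on that input. *)
Definition NP (A : finType) (L : seq A -> Prop) : Prop :=
  exists (M : ntm A) (p : {poly nat}),
    (forall x, L x <-> accepts M x) /\
    (forall x, L x -> exists2 n, n <= p.[size x]%R & accepts_in M x n).

(** * Binary 2-realization *)

(** Number of occurrences of [u] as a scattered subword of [w]: number of
    increasing sequences of (0-based) positions of [w] that spell [u]. *)
Definition occ (T : eqType) (w u : seq T) : nat :=
  #|[set i : (size u).-tuple 'I_(size w) |
      sorted ltn (map val i) && (map (tnth (in_tuple w)) i == u)]|.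

(** [2.-bseq Sigma] is the type of the words over [Sigma] of length at most 2. *)
Definition profile2 (Sigma : finType) (w : seq Sigma) :
    {ffun 2.-bseq Sigma -> nat} :=
  [ffun u : 2.-bseq Sigma => occ w u].

Definition realizable2 (Sigma : finType) (nu : {ffun 2.-bseq Sigma -> nat}) :
    Prop :=
  exists w : seq Sigma, nu = profile2 w.

(** The coordinates of an input vector are listed by increasing length of the
    word, and lexicographically for words of equal length. *)
Definition words2 (Sigma : finType) : seq (2.-bseq Sigma) :=
  @Bseq 2 Sigma [::] isT ::
  [seq @Bseq 2 Sigma [:: a] isT | a <- enum Sigma] ++
  [seq @Bseq 2 Sigma [:: a; b] isT | a <- enum Sigma, b <- enum Sigma].

Lemma mem_words2 (Sigma : finType) (u : 2.-bseq Sigma) : u \in words2 Sigma.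
Proof.
rewrite /words2 in_cons mem_cat; case: u => [[|a [|b [|c s]]] us] //.
- apply/or3P/Or32/mapP; exists a; first by rewrite mem_enum.
  exact/val_inj.
apply/or3P/Or33/allpairsP; exists (a, b); rewrite !mem_enum; split => //.
exact/val_inj.
Qed.

Lemma uniq_words2 (Sigma : finType) : uniq (words2 Sigma).
Proof.
rewrite /words2 cons_uniq mem_cat negb_or cat_uniq -!andbA; apply/and5P; split.
- by apply/mapP => -[a _ /(congr1 val)].
- by apply/allpairsP => -[p [_ _ /(congr1 val)]].
- by rewrite map_inj_uniq ?enum_uniq // => a b [->].
- by apply/hasPn => _ /allpairsP[[a b] [_ _ ->]]; apply/mapP => -[c _ /(congr1 val)].
by apply: allpairs_uniq; rewrite ?enum_uniq // => -[a b] [c d] _ _ [-> ->].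
Qed.

(** Binary digits without leading zeros, least significant digit first; there
    are [up_log 2 n.+1] of them, hence none when [n = 0]. *)
Definition binary (n : nat) : seq bool :=
  mkseq (fun i => odd (n %/ 2 ^ i)) (up_log 2 n.+1).

(** Digits are [Some true] and [Some false]; [None] ends each coordinate. The
    number [1 + #|Sigma| + #|Sigma| ^ 2] of coordinates determines [#|Sigma|],
    so the alphabet need not be written separately. *)
Definition encode (Sigma : finType) (nu : {ffun 2.-bseq Sigma -> nat}) :
    seq (option bool) :=
  flatten [seq rcons (map Some (binary (nu u))) None | u <- words2 Sigma].

(** The decision problem, as the language of the encodings of its
    yes-instances. *)
Definition binary_2_realization (s : seq (option bool)) : Prop :=
  exists (Sigma : finType) (nu : {ffun 2.-bseq Sigma -> nat}),
    s = encode nu /\ realizable2 nu.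

(* Main.v *)
Require Import Defs.
From HB Require Import structures.
From mathcomp Require Import all_boot all_order all_algebra zify.

Set Implicit Arguments.
Unset Strict Implicit.
Unset Printing Implicit Defensive.

(** A word may be exponentially longer than its profile, so it cannot serve as a
    certificate; but each profile that is realized is realized by a word with
    polynomially many runs, whose lengths can be written in binary.

    To see this, write a word as a list of runs and let only the exponents [m j] of the
    runs of one letter [c] vary. The pairs ending in [c] are then counted by linear forms
    [\sum_j m j * Q b j], where [Q b j] is the number of letters [b] before run [j]; the
    pairs starting with [c] are complementary to them, and the pairs [c c] depend only on
    the sum of the exponents ([pairs_exchange]). If there are too many runs of [c], two different
    sets [X] and [Y] of them have the same cardinality and the same sums of [Q b] for
    each [b], because a set of runs has more subsets than these vectors have values
    ([equal_subset_sums]). Decreasing the exponents on [X :\: Y] and increasing them on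
    [Y :\: X] by the same amount preserves the profile, and does so until a run vanishes
    ([remove_run]). Hence polynomially many runs of each letter suffice ([few_runs]).

    The certificate is a list of commands that write such a word, one power [c ^ (2 ^ i)]
    after the other ([istep], [exists_cert]). The verifier guesses the number of letters
    and the certificate. It then replays the certificate once for each pair of letters,
    maintaining the number of pairs by additions and doublings ([pass_inv]), and compares
    the result with the next coordinate of the input. The counts of single letters are
    treated as pairs whose first letter is a virtual one in front of the word.

    The verifier is written as a regular expression over pushes, pops and emptiness tests
    on a fixed number of stacks. A Turing machine simulates it with one tape per stack and
    with the finitely many continuations of the program as states ([exec_accepts_in],
    [accepts_exec]). Correctness is stated separately for all executions ([all_runs],
    giving soundness) and for one short execution ([some_run], giving completeness in
    polynomial time), so that guesses need to be right in the second case only. *)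

(** * Nondeterministic programs on stacks *)

Section Programs.
Variables (K : nat) (G : finType).

Local Notation reg := 'I_K.+1.

(** An action pushes or pops a given symbol, or tests a stack for emptiness. It is
    a sum type rather than an inductive type to inherit a [choiceType] structure. *)
Definition action : Type := (bool * (reg * G)) + reg.

(** Regular expressions over the actions. Together with actions that get stuck when
    their test fails, [Alt] and [Star] give conditionals, loops and guesses. *)
Inductive prog :=
  | Skip
  | Act of action
  | Seq of prog & prog
  | Alt of prog & prog
  | Star of prog.

Definition Push (i : reg) (a : G) := Act (inl (true, (i, a))).
Definition Pop (i : reg) (a : G) := Act (inl (false, (i, a))).
Definition Empty (i : reg) := Act (inr i).

Definition store := reg -> seq G.

Definition upd (s : store) (i : reg) (v : seq G) : store :=
  fun j => if j == i then v else s j.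

(** The last argument is exactly the number of steps of the compiled machine: a push
    takes two, and unfolding a constructor takes one. *)
Inductive exec : prog -> store -> store -> nat -> Prop :=
  | ExSkip s : exec Skip s s 1
  | ExPush i a s : exec (Push i a) s (upd s i (a :: s i)) 2
  | ExPop i a s l : s i = a :: l -> exec (Pop i a) s (upd s i l) 1
  | ExEmpty i s : s i = [::] -> exec (Empty i) s s 1
  | ExSeq p q s1 s2 s3 n m :
      exec p s1 s2 n -> exec q s2 s3 m -> exec (Seq p q) s1 s3 (n + m).+1
  | ExAltl p q s1 s2 n : exec p s1 s2 n -> exec (Alt p q) s1 s2 n.+1
  | ExAltr p q s1 s2 n : exec q s1 s2 n -> exec (Alt p q) s1 s2 n.+1
  | ExStop p s : exec (Star p) s s 1
  | ExIter p s1 s2 s3 n m :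
      exec p s1 s2 n -> exec (Star p) s2 s3 m -> exec (Star p) s1 s3 (n + m).+1.

(** Programs are embedded into trees only to obtain decidable equality, which the
    states of the machine need. *)
Fixpoint prog_tree (p : prog) : GenTree.tree action :=
  match p with
  | Skip => GenTree.Node 0 [::]
  | Act x => GenTree.Leaf x
  | Seq p q => GenTree.Node 1 [:: prog_tree p; prog_tree q]
  | Alt p q => GenTree.Node 2 [:: prog_tree p; prog_tree q]
  | Star p => GenTree.Node 3 [:: prog_tree p]
  end.

Fixpoint tree_prog (t : GenTree.tree action) : prog :=
  match t with
  | GenTree.Leaf x => Act x
  | GenTree.Node 1 [:: t; u] => Seq (tree_prog t) (tree_prog u)
  | GenTree.Node 2 [:: t; u] => Alt (tree_prog t) (tree_prog u)
  | GenTree.Node 3 [:: t] => Star (tree_prog t)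
  | _ => Skip
  end.

Lemma prog_treeK : cancel prog_tree tree_prog.
Proof. by elim=> //= [p -> q ->|p -> q ->|p ->]. Qed.

HB.instance Definition _ := Choice.copy prog (can_type prog_treeK).

(** A continuation is the list of the programs that remain to be executed. [conts p k]
    lists all those that an execution of [p] followed by [k] goes through before it
    reaches [k]; there are finitely many because the body of a loop resumes that same
    loop. *)
Fixpoint conts (p : prog) (k : seq prog) : seq (seq prog) :=
  (p :: k) ::
  match p with
  | Seq p q => conts p (q :: k) ++ conts q k
  | Alt p q => conts p k ++ conts q k
  | Star p => conts p (Star p :: k)
  | _ => [::]
  end.

Definition next_conts (k : seq prog) : seq (seq prog) :=
  match k with
  | [::] => [::]
  | Skip :: k | Act _ :: k => [:: k]
  | Seq p q :: k => [:: [:: p, q & k]]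
  | Alt p q :: k => [:: p :: k; q :: k]
  | Star p :: k => [:: k; [:: p, Star p & k]]
  end.

Lemma mem_conts p k : p :: k \in conts p k.
Proof. by case: p => *; rewrite /= mem_head. Qed.

Lemma conts_closed p k l l' :
  l \in conts p k -> l' \in next_conts l -> l' \in k :: conts p k.
Proof.
elim: p k l l' => [|x|p IHp q IHq|p IHp q IHq|p IHp] k l l' /=.
- by rewrite !mem_seq1 => /eqP-> /=; rewrite !inE => ->.
- by rewrite !mem_seq1 => /eqP-> /=; rewrite !inE => ->.
all: rewrite in_cons => /predU1P[->|] /=.
- by rewrite mem_seq1 => /eqP->; rewrite !inE mem_cat mem_conts !orbT.
- rewrite mem_cat => /orP[/IHp H /H|/IHq H /H]; rewrite !inE mem_cat.
    by case/predU1P=> [->|->]; rewrite ?mem_conts ?orbT.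
  by case/orP=> ->; rewrite ?orbT.
- by rewrite !inE mem_cat => /orP[]/eqP->; rewrite mem_conts !orbT.
- by rewrite mem_cat => /orP[/IHp H /H|/IHq H /H]; rewrite !inE mem_cat;
    case/orP=> ->; rewrite ?orbT.
- by rewrite !inE => /predU1P[->|/eqP->]; rewrite ?eqxx ?mem_conts ?orbT.
by move=> /IHp H /H; rewrite !inE; case/orP=> ->; rewrite ?orbT.
Qed.

(** A syntactic overapproximation of the stacks that are modified, so that frame
    conditions on concrete programs hold by computation. *)
Fixpoint touch (p : prog) (l : reg) : bool :=
  match p with
  | Act (inl (_, (i, _))) => l == i
  | Seq p q | Alt p q => touch p l || touch q l
  | Star p => touch p l
  | _ => false
  end.

Lemma exec_frame p s s' n l : exec p s s' n -> ~~ touch p l -> s' l = s l.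
Proof.
elim=> {p s s' n} //=.
- by move=> i a s; rewrite /upd; case: (l == i).
- by move=> i a s v; rewrite /upd; case: (l == i).
- by move=> p q s1 s2 s3 n m _ IH1 _ IH2; rewrite negb_or => /andP[/IH1<- /IH2].
- by move=> p q s1 s2 n _ IH; rewrite negb_or => /andP[/IH].
- by move=> p q s1 s2 n _ IH; rewrite negb_or => /andP[_ /IH].
- by move=> p s1 s2 s3 n m _ IH1 _ IH2 H; rewrite IH2 // IH1.
Qed.

End Programs.

(** * Compilation into Turing machines *)

Definition move_code (m : move) : option bool :=
  match m with MoveLeft => Some false | Stay => None | MoveRight => Some true end.
Definition code_move (c : option bool) : move :=
  match c with Some false => MoveLeft | None => Stay | Some true => MoveRight end.
Lemma move_codeK : cancel move_code code_move. Proof. by case. Qed.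
HB.instance Definition _ := Equality.copy move (can_type move_codeK).

Section Compile.
Variables (A W : finType) (K : nat).
Local Notation G := (A + W)%type.
Local Notation R := 'I_K.+1.
Local Notation prog := (prog K G).
Local Notation symbol := (option G).

Definition keep (r : {ffun R -> symbol}) : {ffun R -> symbol * move} :=
  [ffun i => (r i, Stay)].

Definition on (r : {ffun R -> symbol}) (i : R) (x : symbol * move) :
    {ffun R -> symbol * move} :=
  [ffun j => if j == i then x else (r j, Stay)].

(** Moving the head left before writing makes a push take two steps; the first
    component of a state is the write that remains to be done. *)
Definition raw_state : Type := option (R * G) * seq prog.

Definition succs (q : raw_state) (r : {ffun R -> symbol}) :
    seq (raw_state * {ffun R -> symbol * move}) :=
  match q with
  | (Some (i, a), k) => [:: ((None, k), on r i (Some a, Stay))]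
  | (None, Act (inl (true, (i, a))) :: k) =>
      [:: ((Some (i, a), k), on r i (r i, MoveLeft))]
  | (None, Act (inl (false, (i, a))) :: k) =>
      if r i == Some a then [:: ((None, k), on r i (r i, MoveRight))] else [::]
  | (None, Act (inr i) :: k) =>
      if r i == None then [:: ((None, k), keep r)] else [::]
  | (None, k) => [seq ((None, l), keep r) | l <- next_conts k]
  end.

Variable p0 : prog.

(** The empty continuation is the accepting one. *)
Definition prog_conts : seq (seq prog) := [::] :: conts p0 [::].

Definition mach_state : finType := (option (R * G) * seq_sub prog_conts)%type.

Definition raw (q : mach_state) : raw_state := (q.1, val q.2).

Lemma start_prog_conts : [:: p0] \in prog_conts.
Proof. by rewrite inE mem_conts orbT. Qed.

Definition start_state : mach_state := (None, SeqSub start_prog_conts).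

Definition machine : ntm A :=
  @Ntm A K W mach_state start_state (fun q => raw q == (None, [::]))
    (fun q r q' b => (raw q', b) \in succs (raw q) r).

(** A stack is kept on the part of its tape from the head rightwards, the top being
    scanned. The cells to the left of the head are unconstrained: a push overwrites
    the one that it uncovers. The blanks at the end are those that the machine wrote
    while it scanned an empty stack. *)
Definition repr (c : config machine) (s : store K G) : Prop :=
  forall i : R, exists n, rhs (conf_tapes c i) = map Some (s i) ++ nseq n None.

Definition input_store (x : seq A) : store K G :=
  fun i => if i == ord0 then map inl x else [::].

Lemma repr_init x : repr (init machine x) (input_store x).
Proof.
move=> i; exists 0; rewrite ffunE /= cats0 /input_store.
by case: (i == ord0); rewrite // -map_comp.
Qed.

Lemma read_repr c s i : repr c s -> read None (conf_tapes c i) = ohead (s i).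
Proof.
by move/(_ i) => [n]; rewrite /read => ->; case: (s i) => //=; case: n.
Qed.

Lemma shift_stay (t : tape symbol) l n :
  rhs t = map Some l ++ nseq n None ->
  exists m, rhs (shift None Stay (write (read None t) t)) = map Some l ++ nseq m None.
Proof.
rewrite /= /read => ->; case: l => [|a l] /=; last by exists n.
by case: n => [|n]; [exists 1 | exists n.+1].
Qed.

Definition conf_succ (c c' : config machine) (x : raw_state * {ffun R -> symbol * move}) :=
  raw (conf_state c') = x.1 /\
  conf_tapes c' =
    [ffun i => shift None (x.2 i).2 (write (x.2 i).1 (conf_tapes c i))].

Lemma stepP (c c' : config machine) :
  step c c' <-> exists2 x, x \in succs (raw (conf_state c))
        [ffun i => read None (conf_tapes c i)] & conf_succ c c' x.
Proof.
split=> [[b [tr ct]]|[[q b] xin [/= qE ct]]].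
  by exists (raw (conf_state c'), b).
by exists b; split=> //=; rewrite qE.
Qed.

Lemma repr_keep c c' s q :
  repr c s -> conf_succ c c' (q, keep [ffun i => read None (conf_tapes c i)]) ->
  repr c' s.
Proof.
move=> cs [_ /= ct] i; rewrite ct !ffunE /=.
by have [n] := cs i; apply: shift_stay.
Qed.

Lemma repr_on c c' s i x v q :
  repr c s ->
  conf_succ c c' (q, on [ffun i => read None (conf_tapes c i)] i x) ->
  (exists n, rhs (shift None x.2 (write x.1 (conf_tapes c i))) =
             map Some v ++ nseq n None) ->
  repr c' (upd s i v).
Proof.
move=> cs [_ /= ct] H j; rewrite ct !ffunE /upd.
case: eqP => [->//|_]; rewrite /=.
by have [n] := cs j; apply: shift_stay.
Qed.

(** The situation in the middle of a push on [i], where an arbitrary cell covers the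
    stack. *)
Definition half_repr (c : config machine) (s : store K G) (i : R) : Prop :=
  exists g, forall j : R, exists n, rhs (conf_tapes c j) =
    (if j == i then cons g else id) (map Some (s j) ++ nseq n None).

Lemma push_left c c' s i q : repr c s ->
  conf_succ c c' (q, on [ffun j => read None (conf_tapes c j)] i
                       (read None (conf_tapes c i), MoveLeft)) ->
  half_repr c' s i.
Proof.
move=> cs [_ /= ct]; exists (head None (lhs (conf_tapes c i))) => j.
rewrite ct !ffunE; have [n jn] := cs j; case: eqP => [ji|_] /=; last first.
  by have := shift_stay jn.
rewrite -ji; have [m Em] := shift_stay jn; exists m; rewrite -Em.
by [].
Qed.

Lemma push_write c c' s i a q : half_repr c s i ->
  conf_succ c c' (q, on [ffun j => read None (conf_tapes c j)] i (Some a, Stay)) ->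
  repr c' (upd s i (a :: s i)).
Proof.
move=> [g cs] [_ /= ct] j; rewrite ct !ffunE /upd.
have [n jn] := cs j; move: jn; case: eqP => [-> /=|_ jn].
  by move=> ->; exists n.
by have := shift_stay jn.
Qed.

Lemma repr_pop c c' s i a l q : repr c s -> s i = a :: l ->
  conf_succ c c' (q, on [ffun j => read None (conf_tapes c j)] i
                       (read None (conf_tapes c i), MoveRight)) ->
  repr c' (upd s i l).
Proof.
move=> cs si; move/(repr_on cs); apply; have [n] := cs i.
by rewrite si /= => ->; exists n.
Qed.

Local Notation rd c := [ffun i => read None (conf_tapes c i)].

(** An accepting computation that starts with [p :: k] contains an execution of [p]
    that ends with [k]. The strict decrease of the number of steps lets the induction
    go through [Star p], whose continuation contains [Star p] again. *)
Lemma machine_sound n c c' s p k :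
  repr c s -> raw (conf_state c) = (None, p :: k) ->
  reaches n c c' -> raw (conf_state c') = (None, [::]) ->
  exists s1 m1 m2 c1, [/\ exec p s s1 m1, m2 < n, reaches m2 c1 c',
     repr c1 s1 & raw (conf_state c1) = (None, k)].
Proof.
elim/ltn_ind: n c s p k => -[|n] IH c s p k cs qE /=.
  by move=> <-; rewrite qE.
move=> [c1 /stepP[x xin xs] rn] fin; move: xin; rewrite qE.
case: p qE => [|[[[] [i a]]|i]|p q|p q|p] qE /=.
- rewrite mem_seq1 => /eqP xE; subst x; exists s, 1, n, c1; split=> //.
  + exact: ExSkip.
  + exact: repr_keep cs xs.
  + by case: xs.
- rewrite mem_seq1 ffunE => /eqP xE; subst x; have h := push_left cs xs.
  case: xs => /= q1 _; case: n rn IH => [|n] /=.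
    by move=> E; move: fin; rewrite -E q1.
  move=> [c2 /stepP[y yin ys] rn] _; move: yin; rewrite q1 mem_seq1 => /eqP yE; subst y.
  exists (upd s i (a :: s i)), 2, n, c2; split=> //.
  + exact: ExPush.
  + exact: push_write h ys.
  + by case: ys.
- rewrite ffunE (read_repr i cs); case: eqP => // sE; rewrite mem_seq1 => /eqP xE; subst x.
  case si: (s i) sE => [//|b l] [ab]; rewrite {b}ab in si.
  exists (upd s i l), 1, n, c1; split=> //.
  + exact: ExPop.
  + by apply: (repr_pop cs si); rewrite -(read_repr i cs) in xs; exact: xs.
  + by case: xs.
- rewrite ffunE (read_repr i cs); case: eqP => // sE; rewrite mem_seq1 => /eqP xE; subst x.
  exists s, 1, n, c1; split=> //.
  + by apply: ExEmpty; case: (s i) sE.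
  + exact: repr_keep cs xs.
  + by case: xs.
- rewrite mem_seq1 => /eqP xE; subst x; have cs1 := repr_keep cs xs.
  case: xs => /= q1 _.
  have [s2 [m1 [m2 [c2 [e1 lt1 r2 cs2 q2]]]]] := IH n (leqnn _) _ _ _ _ cs1 q1 rn fin.
  have [s3 [m3 [m4 [c3 [e3 lt3 r3 cs3 q3]]]]] := IH m2 (ltnW lt1) _ _ _ _ cs2 q2 r2 fin.
  exists s3, (m1 + m3).+1, m4, c3; split=> //; first exact: ExSeq e1 e3.
  by rewrite ltnS ltnW // (ltn_trans lt3).
- rewrite !inE => /orP[] /eqP xE; subst x; have cs1 := repr_keep cs xs;
  case: xs => /= q1 _;
  have [s2 [m1 [m2 [c2 [e1 lt1 r2 cs2 q2]]]]] := IH n (leqnn _) _ _ _ _ cs1 q1 rn fin;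
  exists s2, m1.+1, m2, c2; split=> //; try exact: (ltn_trans lt1).
  + exact: ExAltl.
  + exact: ExAltr.
- rewrite !inE => /orP[] /eqP xE; subst x; have cs1 := repr_keep cs xs;
  case: xs => /= q1 _.
    by exists s, 1, n, c1; split=> //; exact: ExStop.
  have [s2 [m1 [m2 [c2 [e1 lt1 r2 cs2 q2]]]]] := IH n (leqnn _) _ _ _ _ cs1 q1 rn fin.
  have [s3 [m3 [m4 [c3 [e3 lt3 r3 cs3 q3]]]]] := IH m2 (ltnW lt1) _ _ _ _ cs2 q2 r2 fin.
  exists s3, (m1 + m3).+1, m4, c3; split=> //; first exact: ExIter e1 e3.
  by rewrite ltnS ltnW // (ltn_trans lt3).
Qed.

Lemma prog_conts_next k l : k \in prog_conts -> l \in next_conts k -> l \in prog_conts.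
Proof.
by rewrite inE => /orP[/eqP->//|kp lk]; apply: conts_closed kp lk.
Qed.

(** The state type itself ensures that the continuations met during a computation are
    among the listed ones. *)
Lemma raw_prog_conts (c : config machine) k : raw (conf_state c) = (None, k) -> k \in prog_conts.
Proof. by case: c => -[o [l lin]] t [_ <-]. Qed.

Lemma step_succ (c : config machine) o l b :
  ((o, l), b) \in succs (raw (conf_state c)) (rd c) -> l \in prog_conts ->
  exists c', step c c' /\ conf_succ c c' ((o, l), b).
Proof.
move=> xin lin; pose c' := @Config A machine ((o, SeqSub lin) : mach_state)
  [ffun i => shift None (b i).2 (write (b i).1 (conf_tapes c i))].
have c'P : conf_succ c c' ((o, l), b) by [].
by exists c'; split=> //; apply/stepP; exists ((o, l), b).
Qed.

Lemma step_silent c s k l : repr c s -> raw (conf_state c) = (None, k) ->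
  l \in next_conts k -> (forall x k', k = Act x :: k' -> False) ->
  exists c', [/\ step c c', repr c' s & raw (conf_state c') = (None, l)].
Proof.
move=> cs qE lk nact; have lin := prog_conts_next (raw_prog_conts qE) lk.
have xin : ((None, l), keep (rd c)) \in succs (raw (conf_state c)) (rd c).
  rewrite qE; move: lk nact; case: k {qE} => [|[|x|p q|p q|p] k] // lk nact;
    try exact: map_f lk.
  by case: (nact x k).
have [c' [st c'P]] := step_succ xin lin.
by exists c'; split; [|exact: repr_keep cs c'P|by case: c'P].
Qed.

Lemma reaches_cat n m (c c1 c' : config machine) :
  reaches n c c1 -> reaches m c1 c' -> reaches (n + m) c c'.
Proof.
elim: n c => [|n IH] c /=; first by move=> ->.
by move=> [c2 s2 r2] /(IH _ r2); exists c2.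
Qed.

Lemma machine_complete p s s' n : exec p s s' n ->
  forall c k, repr c s -> raw (conf_state c) = (None, p :: k) ->
  exists c', [/\ reaches n c c', repr c' s' & raw (conf_state c') = (None, k)].
Proof.
elim=> {p s s' n}.
- move=> s c k cs qE.
  have [//|c1 [st1 cs1 q1]] := step_silent cs qE (mem_head _ _) _.
  by exists c1; split=> //; exists c1.
- move=> i a s c k cs qE.
  have lin : k \in prog_conts by apply: prog_conts_next (raw_prog_conts qE) _; rewrite mem_head.
  have x1 : ((Some (i, a), k), on (rd c) i (read None (conf_tapes c i), MoveLeft))
      \in succs (raw (conf_state c)) (rd c) by rewrite qE /= ffunE mem_head.
  have [c1 [st1 c1P]] := step_succ x1 lin; have [q1 _] := c1P.
  have x2 : ((None, k), on (rd c1) i (Some a, Stay)) \in succs (raw (conf_state c1)) (rd c1).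
    by rewrite q1 mem_head.
  have [c2 [st2 c2P]] := step_succ x2 lin; have [q2 _] := c2P.
  exists c2; split=> //; last exact: push_write (push_left cs c1P) c2P.
  by exists c1 => //; exists c2.
- move=> i a s l si c k cs qE.
  have lin : k \in prog_conts by apply: prog_conts_next (raw_prog_conts qE) _; rewrite mem_head.
  have x1 : ((None, k), on (rd c) i (read None (conf_tapes c i), MoveRight))
      \in succs (raw (conf_state c)) (rd c).
    by rewrite qE /= !ffunE (read_repr i cs) si /= eqxx mem_head.
  have [c1 [st1 c1P]] := step_succ x1 lin; have [q1 _] := c1P.
  by exists c1; split=> //; [exists c1 | exact: repr_pop cs si c1P].
- move=> i s si c k cs qE.
  have lin : k \in prog_conts by apply: prog_conts_next (raw_prog_conts qE) _; rewrite mem_head.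
  have x1 : ((None, k), keep (rd c)) \in succs (raw (conf_state c)) (rd c).
    by rewrite qE /= !ffunE (read_repr i cs) si /= mem_head.
  have [c1 [st1 c1P]] := step_succ x1 lin; have [q1 _] := c1P.
  by exists c1; split=> //; [exists c1 | exact: repr_keep cs c1P].
- move=> p q s1 s2 s3 n m _ IH1 _ IH2 c k cs qE.
  have [//|c1 [st1 cs1 q1]] := step_silent cs qE (mem_head _ _) _.
  have [c2 [r2 cs2 q2]] := IH1 _ _ cs1 q1.
  have [c3 [r3 cs3 q3]] := IH2 _ _ cs2 q2.
  by exists c3; split=> //; exists c1 => //; apply: reaches_cat r3.
- move=> p q s1 s2 n _ IH c k cs qE.
  have lk : p :: k \in next_conts (Alt p q :: k) by rewrite inE eqxx.
  have [//|c1 [st1 cs1 q1]] := step_silent cs qE lk _.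
  have [c2 [r2 cs2 q2]] := IH _ _ cs1 q1.
  by exists c2; split=> //; exists c1.
- move=> p q s1 s2 n _ IH c k cs qE.
  have lk : q :: k \in next_conts (Alt p q :: k) by rewrite !inE eqxx orbT.
  have [//|c1 [st1 cs1 q1]] := step_silent cs qE lk _.
  have [c2 [r2 cs2 q2]] := IH _ _ cs1 q1.
  by exists c2; split=> //; exists c1.
- move=> p s c k cs qE.
  have lk : k \in next_conts (Star p :: k) by rewrite inE eqxx.
  have [//|c1 [st1 cs1 q1]] := step_silent cs qE lk _.
  by exists c1; split=> //; exists c1.
- move=> p s1 s2 s3 n m _ IH1 _ IH2 c k cs qE.
  have lk : [:: p, Star p & k] \in next_conts (Star p :: k) by rewrite !inE eqxx orbT.
  have [//|c1 [st1 cs1 q1]] := step_silent cs qE lk _.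
  have [c2 [r2 cs2 q2]] := IH1 _ _ cs1 q1.
  have [c3 [r3 cs3 q3]] := IH2 _ _ cs2 q2.
  by exists c3; split=> //; exists c1 => //; apply: reaches_cat r3.
Qed.

Lemma exec_accepts_in x s n :
  exec p0 (input_store x) s n -> accepts_in machine x n.
Proof.
move=> /machine_complete /(_ _ _ (repr_init x) (erefl _)) [c [r _ q]].
by exists c => //=; rewrite q.
Qed.

Lemma accepts_exec x :
  accepts machine x -> exists s n, exec p0 (input_store x) s n.
Proof.
case=> n [c r /= /eqP q].
have [s [m [_ [_ [e _ _ _ _]]]]] := machine_sound (repr_init x) (erefl _) r q.
by exists s, m.
Qed.

End Compile.

(** * Counting pairs of letters *)

(** One pass over [w] that counts in [p] the letters satisfying [f] and in [s] the pairs
    of positions whose letters satisfy [f] and then [g]. The initial value of [p] stands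
    for letters read before [w]. *)
Fixpoint scan (T : Type) (f g : pred T) (p s : nat) (w : seq T) : nat * nat :=
  if w is c :: w' then scan f g (p + f c) (s + g c * p) w' else (p, s).

Lemma scan_rcons T (f g : pred T) p s w c :
  scan f g p s (rcons w c) =
    ((scan f g p s w).1 + f c, (scan f g p s w).2 + g c * (scan f g p s w).1).
Proof. by elim: w p s => //=. Qed.

Lemma scan_fst T (f g : pred T) p s w : (scan f g p s w).1 = p + count f w.
Proof. by elim: w p s => [|c w IH] p s /=; rewrite ?IH; lia. Qed.

Lemma scan_map T U (h : T -> U) (f g : pred U) p s w :
  scan f g p s (map h w) = scan (f \o h) (g \o h) p s w.
Proof. by elim: w p s => //=. Qed.

Lemma eq_scan T (f f' g g' : pred T) p s w :
  f =1 f' -> g =1 g' -> scan f g p s w = scan f' g' p s w.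
Proof. by move=> ff gg; elim: w p s => //= c w IH p s; rewrite ff gg. Qed.

Section Counts.
Implicit Types (a b c : nat) (w : seq nat).

(** The letters of [w] are numbered from 0, and the rows of the profile from 1: row
    [b.+1] belongs to letter [b]. Row 0 belongs to a virtual letter that occurs once,
    before [w], so that [pairs 0 b w] is the number of occurrences of [b] ([pairs0]).
    Thus the coordinates of all the nonempty words have the same form. *)
Definition row_letters a w : nat := (a == 0) + count (fun c => c.+1 == a) w.

Definition pairs a b w : nat := (scan (fun c => c.+1 == a) (pred1 b) (a == 0) 0 w).2.

Lemma row_letters_rcons a w c : row_letters a (rcons w c) = row_letters a w + (c.+1 == a).
Proof. by rewrite /row_letters -cats1 count_cat /= addn0 addnA. Qed.

Lemma pairs_rcons a b w c : pairs a b (rcons w c) = pairs a b w + (c == b) * row_letters a w.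
Proof. by rewrite /pairs scan_rcons /= scan_fst. Qed.

Lemma row_letters0 w : row_letters 0 w = 1.
Proof. by rewrite /row_letters; elim: w => //= c w; rewrite add0n. Qed.

Lemma row_lettersS b w : row_letters b.+1 w = count_mem b w.
Proof. by rewrite /row_letters add0n; apply: eq_count => c /=; rewrite eqSS. Qed.

Lemma pairs0 b w : pairs 0 b w = count_mem b w.
Proof.
elim/last_ind: w => [|w c IH] //.
by rewrite pairs_rcons row_letters0 IH -cats1 count_cat /= muln1 addn0.
Qed.

Lemma pairs_diag b w : pairs b.+1 b w = 'C(row_letters b.+1 w, 2).
Proof.
elim/last_ind: w => [|w c IH] //; rewrite pairs_rcons row_letters_rcons IH eqSS.
by case: (c == b); rewrite ?mul0n ?addn0 // mul1n addn1 binS bin1.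
Qed.

(** Each occurrence of [b] comes either before or after each occurrence of [c]. Hence
    only one of the two counts has to be controlled when [w] is modified. *)
Lemma pairs_sym b c w : b != c ->
  pairs b.+1 c w + pairs c.+1 b w = row_letters b.+1 w * row_letters c.+1 w.
Proof.
move=> bc; elim/last_ind: w => [|w d IH] //.
rewrite !pairs_rcons !row_letters_rcons !eqSS.
have [->|db] := eqVneq d b; first by rewrite (negbTE bc) /=; nia.
by case: (d == c); nia.
Qed.

Lemma row_letters_cat_nseq a w n c : row_letters a (w ++ nseq n c) = row_letters a w + (c.+1 ==
  a) * n.
Proof. by rewrite /row_letters count_cat count_nseq addnA. Qed.

Lemma pairs_cat_nseq a b w n c : pairs a b (w ++ nseq n c) =
  pairs a b w + (c == b) * (n * row_letters a w + (c.+1 == a) * 'C(n, 2)).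
Proof.
elim: n => [|n IH]; first by rewrite /= cats0 mul0n bin0n /= !muln0 addn0.
rewrite -addn1 nseqD catA cats1 pairs_rcons IH row_letters_cat_nseq addn1 binS bin1.
by case: (c == b); case: (c.+1 == a); nia.
Qed.

Lemma sum_count_letters k w : all (gtn k) w -> \sum_(b < k) count_mem (b : nat) w = size w.
Proof.
elim: w => [|c w IH] /=; first by rewrite big1.
move=> /andP[ck /IH <-]; rewrite big_split /= (bigD1 (Ordinal ck)) //= eqxx big1 //.
by move=> i; rewrite -val_eqE /= eq_sym => /negbTE->.
Qed.

End Counts.

(** * Words with few runs *)

Definition run_word (r : seq (nat * nat)) : seq nat := flatten [seq nseq x.2 x.1 | x <- r].

(** The letter of each run is fixed in this section, and the exponents vary: the
    counts become polynomials of degree at most 2 in the exponents. *)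
Section Exponents.
Variables (l : nat -> nat).
Implicit Types (m : nat -> nat).

Definition expand m r : seq nat := run_word (mkseq (fun j => (l j, m j)) r).

Lemma expandS m r : expand m r.+1 = expand m r ++ nseq (m r) (l r).
Proof. by rewrite /expand /run_word mkseqS map_rcons flatten_rcons. Qed.

Lemma row_letters_expand m a r :
  row_letters a (expand m r) = (a == 0) + \sum_(j < r | (l j).+1 == a) m j.
Proof.
elim: r => [|r IH]; first by rewrite big_ord0.
rewrite expandS row_letters_cat_nseq IH [in RHS]big_mkcond big_ord_recr -big_mkcond /=.
by case: ifP; lia.
Qed.

Lemma pairs_expand m a b r : a != b.+1 ->
  pairs a b (expand m r) = \sum_(j < r | l j == b) m j * row_letters a (expand m j).
Proof.
move=> ab; elim: r => [|r IH]; first by rewrite big_ord0.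
rewrite expandS pairs_cat_nseq IH [in RHS]big_mkcond big_ord_recr -big_mkcond /=.
by have [->|//] := eqVneq (l r) b; rewrite eq_sym (negbTE ab) //; lia.
Qed.

(** If only the exponents of the runs of [c] change, the pairs [b c] with [b != c]
    depend on these exponents linearly, with coefficients the numbers of letters [b] before the
    run. When these linear forms and the total exponent are preserved, so are the pairs
    starting with [c], by [pairs_sym], and the pairs [c c], by [pairs_diag]. *)
Lemma pairs_exchange k c m m' r : (forall j, l j != c -> m' j = m j) ->
  \sum_(j < r | l j == c) m' j = \sum_(j < r | l j == c) m j ->
  (forall b, b < k -> b != c ->
     \sum_(j < r | l j == c) m' j * row_letters b.+1 (expand m j) =
     \sum_(j < r | l j == c) m j * row_letters b.+1 (expand m j)) ->
  forall a b, a <= k -> b < k -> pairs a b (expand m' r) = pairs a b (expand m r).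
Proof.
move=> mm' sumE sumcE.
have cE a q : a != c.+1 -> row_letters a (expand m' q) = row_letters a (expand m q).
  move=> ac; rewrite !row_letters_expand; congr (_ + _); apply: eq_bigr => j /eqP ja.
  by apply: mm'; rewrite -eqSS ja.
have cEr a : row_letters a (expand m' r) = row_letters a (expand m r).
  have [->|] := eqVneq a c.+1; last exact: cE.
  by rewrite !row_letters_expand; congr (_ + _); exact: sumE.
have main a b : a <= k -> b < k -> a != c.+1 ->
    pairs a b (expand m' r) = pairs a b (expand m r).
  move=> ak bk ac; have [->|ab] := eqVneq a b.+1; first by rewrite !pairs_diag cEr.
  rewrite !pairs_expand //; have [bc|bc] := eqVneq b c; last first.
    by apply: eq_bigr => j /eqP jb; rewrite mm' ?jb // cE.
  transitivity (\sum_(j < r | l j == b) m' j * row_letters a (expand m j)).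
    by apply: eq_bigr => j _; rewrite cE.
  rewrite bc; case: a ak ac ab => [|a] ak ac ab.
    rewrite (eq_bigr (fun j : 'I_r => m' j)) => [|j _]; last by rewrite row_letters0 muln1.
    by rewrite sumE; apply: eq_bigr => j _; rewrite row_letters0 muln1.
  by apply: sumcE => //; rewrite -eqSS.
move=> a b ak bk; have [ac|] := eqVneq a c.+1; last exact: main.
subst a; have [->|bc] := eqVneq b c; first by rewrite !pairs_diag cEr.
have := pairs_sym (expand m' r) bc; have := pairs_sym (expand m r) bc.
by rewrite !cEr (main b.+1 c) ?eqSS // => <-; lia.
Qed.

End Exponents.

(** The left-hand side counts the vectors of [k] numbers that are at most [M * 2 ^ e], and the
    right-hand side the subsets of an [M]-element set. The choice of [M] matters only in that
    it is polynomial in [k] and [e]. *)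
Lemma vectors_lt_subsets k e (q := (k + e).+1) (M := 8 * q ^ 2) :
  (M * 2 ^ e).+1 ^ k < 2 ^ M.
Proof.
have qq : q < 2 ^ q by exact: ltn_expl.
have ME : M <= 2 ^ (2 * q + 3).
  by rewrite /M expnD (mulnC 2) expnM mulnC leq_mul // leq_exp2r // ltnW.
have : (M * 2 ^ e).+1 <= 2 ^ (2 * q + 4 + e).
  have : M * 2 ^ e <= 2 ^ (2 * q + 3 + e) by rewrite expnD leq_mul2r ME orbT.
  rewrite (_ : 2 * q + 4 + e = (2 * q + 3 + e).+1); last by lia.
  by rewrite expnS; have := expn_gt0 2 (2 * q + 3 + e); lia.
move=> H; apply: (@leq_ltn_trans ((2 ^ (2 * q + 4 + e)) ^ k)).
  by case: (posnP k) => [->//|k0]; rewrite leq_exp2r.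
by rewrite -expnM ltn_exp2l // /M /q; nia.
Qed.

(** Pigeonhole principle: a large set has more subsets than there are values for the
    vector of the [k] subset sums. *)
Lemma equal_subset_sums k e (h : nat -> nat -> nat) (r : nat) (J : {set 'I_r}) :
  8 * (k + e).+1 ^ 2 <= #|J| -> (forall b (j : 'I_r), b < k -> h b j <= 2 ^ e) ->
  exists X Y : {set 'I_r}, [/\ X \subset J, Y \subset J, X != Y &
    forall b, b < k -> \sum_(j in X) h b j = \sum_(j in Y) h b j].
Proof.
set M := 8 * _ => MJ hb.
pose J0 := [set j in take M (enum J)].
have J0J : J0 \subset J.
  by apply/subsetP => j; rewrite inE => /mem_take; rewrite mem_enum.
have cJ0 : #|J0| = M.
  rewrite cardsE; have/card_uniqP-> : uniq (take M (enum J)) by rewrite take_uniq // enum_uniq.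
  by rewrite size_takel // -cardE.
pose f (X : {set 'I_r}) : {ffun 'I_k -> 'I_(M * 2 ^ e).+1} :=
  [ffun b : 'I_k => inord (\sum_(j in X) h b j)].
have fb (X : {set 'I_r}) b : b < k -> X \subset J0 -> \sum_(j in X) h b j < (M * 2 ^ e).+1.
  move=> bk /subset_leq_card; rewrite cJ0 => XM; rewrite ltnS.
  apply: (@leq_trans (#|X| * 2 ^ e)); last by rewrite leq_mul2r XM orbT.
  by rewrite -sum_nat_const; apply: leq_sum => j _; apply: hb.
have /dinjectivePn[X XJ [Y /andP[XY YJ] fXY]] : ~~ dinjectiveb f (powerset J0).
  apply/negP => /dinjectiveP /card_in_imset; rewrite card_powerset cJ0 => imE.
  have := max_card [set f X | X in powerset J0].
  by rewrite imE card_ffun !card_ord leqNgt vectors_lt_subsets.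
have {}XJ : X \subset J0 by rewrite powersetE in XJ.
have {}YJ : Y \subset J0 by rewrite inE in YJ.
exists X, Y; split; [exact: subset_trans J0J|exact: subset_trans J0J|by rewrite eq_sym|].
move=> b bk; move/ffunP/(_ (Ordinal bk))/(congr1 val): fXY.
by rewrite !ffunE /= !inordK ?fb.
Qed.

Lemma run_word_expand rl : run_word rl =
  expand (fun j => (nth (0, 0) rl j).1) (fun j => (nth (0, 0) rl j).2) (size rl).
Proof.
rewrite /expand; congr run_word; rewrite -[LHS](mkseq_nth (0, 0)).
by apply: eq_mkseq => j /=; case: (nth _ _ _).
Qed.

Lemma run_word_filter rl : run_word [seq x <- rl | x.2 != 0] = run_word rl.
Proof. by rewrite /run_word; elim: rl => //= -[c [|m]] rl IH //=; rewrite IH. Qed.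

Lemma size_expand l m r : size (expand l m r) = \sum_(j < r) m j.
Proof.
elim: r => [|r IH]; first by rewrite big_ord0.
by rewrite expandS size_cat size_nseq IH big_ord_recr.
Qed.

(** Apply [equal_subset_sums] to the runs of [c], the sums being the cardinality and
    the coefficients of the linear forms of [pairs_exchange]. Decreasing the
    exponents on [X :\: Y] and increasing those on [Y :\: X] by the same amount
    preserves the profile; for the least exponent on [X :\: Y], a run becomes empty. *)
Lemma remove_run k e c (rl : seq (nat * nat)) : c < k ->
  all (fun x => x.1 < k) rl -> size (run_word rl) < 2 ^ e ->
  8 * (k + e).+1 ^ 2 <= count (fun x : nat * nat => x.1 == c) rl ->
  exists rl' : seq (nat * nat), [/\ size rl' < size rl, all (fun x => x.1 < k) rl' &
    forall a b, a <= k -> b < k -> pairs a b (run_word rl') = pairs a b (run_word rl)].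
Proof.
move=> ck alk sz big.
pose l j := (nth (0, 0) rl j).1; pose m j := (nth (0, 0) rl j).2.
set r := size rl; pose J := [set j : 'I_r | l j == c].
have wE : run_word rl = expand l m r by exact: run_word_expand.
(* The coordinate [c], which no linear form uses, serves for the cardinality. *)
pose h (b j : nat) := if b == c then 1 else row_letters b.+1 (expand l m j).
have cJ : count (fun x : nat * nat => x.1 == c) rl = #|J|.
  rewrite -sum1_card -sum1_count (big_nth (0, 0)) big_mkord.
  by apply: eq_bigl => j; rewrite inE.
have hb b (j : 'I_r) : b < k -> h b j <= 2 ^ e.
  move=> bk; rewrite /h; case: eqP => _; first by rewrite expn_gt0.
  rewrite row_lettersS; apply: leq_trans (ltnW sz); apply: leq_trans (count_size _ _) _.
  rewrite wE !size_expand -!(big_mkord xpredT m).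
  have jr : j <= r by rewrite ltnW.
  by rewrite [leqRHS](@big_cat_nat _ _ _ j) //= leq_addr.
rewrite cJ in big.
have [X [Y [XJ YJ XY hXY]]] := equal_subset_sums big hb.
have [j0 j0P] : exists j0, j0 \in X :\: Y.
  apply/set0Pn; apply: contra XY; rewrite setD_eq0 => sXY.
  by rewrite eqEcard sXY; have := hXY c ck; rewrite /h eqxx !sum1_card => ->; exact: leqnn.
pose i0 := [arg min_(i < j0 in X :\: Y) m i].
have [i0P i0min] : i0 \in X :\: Y /\ forall j, j \in X :\: Y -> m i0 <= m j.
  by rewrite /i0; case: arg_minnP => // i iP imin; split.
pose mem_ (Z : {set 'I_r}) (j : nat) := oapp (fun i => i \in Z) false (insub j).
have memE Z (j : 'I_r) : mem_ Z j = (j \in Z) by rewrite /mem_ valK.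
(* On [X :&: Y] the two changes cancel; on [X :\: Y] the subtraction is exact as
   [m i0] is least there. *)
pose m' j := m j + m i0 * mem_ Y j - m i0 * mem_ X j.
have m'E (j : 'I_r) : m' j + m i0 * (j \in X) = m j + m i0 * (j \in Y).
  rewrite /m' !memE subnK //; have := i0min j; rewrite !inE.
  by case: (j \in X); case: (j \in Y) => //= H; rewrite ?muln1 ?muln0 ?addn0 ?leq_addl ?H.
have mJ (Z : {set 'I_r}) b : Z \subset J ->
    \sum_(j < r | l j == c) m i0 * (j \in Z) * h b j = m i0 * \sum_(j in Z) h b j.
  move=> /subsetP ZJ; rewrite big_distrr /= [LHS]big_mkcond [RHS]big_mkcond /=.
  apply: eq_bigr => j _; have := ZJ j; rewrite inE.
  by case: (j \in Z) => [->//|_]; rewrite ?muln1 // muln0 mul0n; case: ifP.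
have sumE b : b < k -> \sum_(j < r | l j == c) m' j * h b j =
                       \sum_(j < r | l j == c) m j * h b j.
  move=> bk; apply: (@addIn (m i0 * \sum_(j in X) h b j)).
  rewrite [in RHS]hXY // -(mJ _ _ XJ) -(mJ _ _ YJ) -!big_split /=.
  by apply: eq_bigr => j _; rewrite -!mulnDl m'E.
have pairsE : forall a b, a <= k -> b < k -> pairs a b (expand l m' r) = pairs a b (expand l m r).
  apply: (@pairs_exchange _ _ c) => [j jc||b bk bc].
  - rewrite /m' /mem_; case: insubP => [i _ ij|_] /=; last by rewrite !muln0 subn0 addn0.
    have iJ : i \notin J by rewrite inE ij.
    have/negbTE-> : i \notin X by apply: contra iJ; apply: (subsetP XJ).
    have/negbTE-> : i \notin Y by apply: contra iJ; apply: (subsetP YJ).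
    by rewrite !muln0 subn0 addn0.
  - have := sumE c ck; rewrite /h eqxx.
    by under eq_bigr do rewrite muln1; under [RHS]eq_bigr do rewrite muln1.
  by have := sumE b bk; rewrite /h (negbTE bc).
pose rl1 := mkseq (fun j => (l j, m' j)) r.
exists [seq x <- rl1 | x.2 != 0]; split=> [||a b ak bk].
- rewrite size_filter -[X in _ < X](size_mkseq (fun j => (l j, m' j))) -/rl1.
  rewrite -[X in _ < X](count_predC (fun x : nat * nat => x.2 != 0) rl1).
  rewrite -[X in X < _]addn0 ltn_add2l -has_count; apply/hasP.
  exists (l i0, m' i0); first by apply: map_f; rewrite mem_iota ltn_ord.
  move: i0P (m'E i0); rewrite inE /= negbK => /andP[/negbTE-> ->].
  by rewrite muln1 muln0 addn0; lia.
- rewrite all_filter; apply/allP => x /mapP[j]; rewrite mem_iota /= => jr -> /=.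
  by apply/implyP => _; have/allP := alk; apply; apply: mem_nth.
by rewrite run_word_filter wE -pairsE.
Qed.

Lemma sum_count_runs k (rl : seq (nat * nat)) : all (fun x => x.1 < k) rl ->
  size rl = \sum_(c < k) count (fun x : nat * nat => x.1 == c) rl.
Proof.
move=> H; rewrite -(size_map fst) -(@sum_count_letters k); last by rewrite all_map.
by apply: eq_bigr => c _; rewrite count_map.
Qed.

Lemma run_word_letters k (rl : seq (nat * nat)) :
  all (fun x => x.1 < k) rl -> all (gtn k) (run_word rl).
Proof.
elim: rl => //= -[c n] r IH /= /andP[ck rk].
by rewrite /run_word /= all_cat all_nseq /= ck orbT IH.
Qed.

(** By [remove_run], a word with as few runs as possible has boundedly many runs of
    each letter. Their exponents may still be exponentially large. *)
Lemma few_runs k e (rl : seq (nat * nat)) : all (fun x => x.1 < k) rl ->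
  size (run_word rl) < 2 ^ e ->
  exists rl' : seq (nat * nat), [/\ size rl' <= k * (8 * (k + e).+1 ^ 2),
    all (fun x => x.1 < k) rl' &
    forall a b, a <= k -> b < k -> pairs a b (run_word rl') = pairs a b (run_word rl)].
Proof.
move: {2}(size rl) (leqnn (size rl)) => n.
elim: n rl => [|n IH] rl sn alk szw; first by exists rl; split=> //; lia.
have [small|large] := leqP (size rl) (k * (8 * (k + e).+1 ^ 2)); first by exists rl.
have [c cP] : exists c : 'I_k, 8 * (k + e).+1 ^ 2 <= count (fun x : nat * nat => x.1 == c) rl.
  apply/existsP; apply: contraLR large => /existsPn H; rewrite -leqNgt (sum_count_runs alk).
  rewrite -[X in X * _](card_ord k) -sum_nat_const; apply: leq_sum => c _.
  by rewrite ltnW // ltnNge.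
have [rl1 [s1 a1 e1]] := remove_run (ltn_ord c) alk szw cP.
have [|//||rl2 [s2 a2 e2]] := IH rl1; first by lia.
  rewrite -(sum_count_letters (run_word_letters a1));
    rewrite -(sum_count_letters (run_word_letters alk)) in szw.
  by under eq_bigr do rewrite -pairs0 e1 // pairs0.
by exists rl2; split=> // a b ak bk; rewrite e2 // e1.
Qed.

(** * Certificates *)

(** A certificate is a list of commands for a writer, whose state consists of the word
    written, a current letter and a current exponent. The commands are: next letter,
    first letter, increment the exponent, and append a power of the current letter,
    after which the exponent is reset. Since the length appended is a power of 2, each
    command changes every count by additions and doublings only. *)
Definition istate : Type := seq nat * nat * nat.

Definition istep k (st : istate) (u : bool * bool) : istate :=
  let: (w, c, i) := st in
  match u with
  | (false, false) => (w, c.+1, i)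
  | (false, true) => (w, 0, i)
  | (true, false) => (w, c, i.+1)
  | (true, true) => (if c < k then w ++ nseq (2 ^ i) c else w, c, 0)
  end.

(** The current letter may become [k], which is no letter; the commands that need a
    letter are then illegal. [istep] is nevertheless total, and never writes [k]. *)
Fixpoint valid k (st : istate) (z : seq (bool * bool)) : bool :=
  if z is u :: z' then
    ((u.1 != u.2) || (st.1.2 < k)) && valid k (istep k st u) z'
  else true.

Lemma valid_cat k st z1 z2 :
  valid k st (z1 ++ z2) = valid k st z1 && valid k (foldl (istep k) st z1) z2.
Proof. by elim: z1 st => //= u z1 IH st; rewrite IH andbA. Qed.

Definition bit_cert (m i : nat) : seq (bool * bool) :=
  if odd (m %/ 2 ^ i) then rcons (nseq i (true, false)) (true, true) else [::].

Definition run_cert (e : nat) (x : nat * nat) : seq (bool * bool) :=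
  (false, true) :: nseq x.1 (false, false) ++
  flatten [seq bit_cert x.2 i | i <- iota 0 e].

Arguments run_cert : simpl never.

Lemma modn_expS m e : m %% 2 ^ e.+1 = m %% 2 ^ e + odd (m %/ 2 ^ e) * 2 ^ e.
Proof.
have e0 : 0 < 2 ^ e by rewrite expn_gt0.
have lt1 := ltn_pmod m e0.
rewrite {1}(divn_eq m (2 ^ e)) -{1}(odd_double_half (m %/ 2 ^ e)) -muln2.
rewrite (_ : _ + _ = (m %/ 2 ^ e)./2 * 2 ^ e.+1 +
           (m %% 2 ^ e + odd (m %/ 2 ^ e) * 2 ^ e)); last by rewrite expnS; lia.
rewrite modnMDl modn_small // expnS; case: odd; lia.
Qed.

Lemma double_cert k w c i j :
  foldl (istep k) (w, c, i) (nseq j (true, false)) = (w, c, i + j) /\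
  valid k (w, c, i) (nseq j (true, false)).
Proof.
elim: j i => [|j IH] i /=; first by rewrite addn0.
by have [-> ->] := IH i.+1; rewrite addSnnS.
Qed.

Lemma next_cert k w c i j : c + j <= k ->
  foldl (istep k) (w, c, i) (nseq j (false, false)) = (w, c + j, i) /\
  valid k (w, c, i) (nseq j (false, false)).
Proof.
elim: j c => [|j IH] c /=; first by rewrite addn0.
by move=> ck; have [|-> ->] := IH c.+1; rewrite ?addSnnS // andbT; split=> //; lia.
Qed.

Lemma bits_cert k w c m e : c < k ->
  let z := flatten [seq bit_cert m i | i <- iota 0 e] in
  [/\ foldl (istep k) (w, c, 0) z = (w ++ nseq (m %% 2 ^ e) c, c, 0),
      valid k (w, c, 0) z & size z <= e * e].
Proof.
move=> ck; elim: e => [|e IH]; first by rewrite /= modn1 cats0.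
cbv zeta; rewrite -[in iota _ _]addn1 iotaD map_cat flatten_cat foldl_cat valid_cat size_cat /=
  add0n cats0.
have [-> -> sz] := IH; rewrite modn_expS /bit_cert; case: odd; last first.
  rewrite /= !addn0; split=> //.
  by apply: leq_trans sz _; rewrite leq_mul.
have [fE vE] := double_cert k (w ++ nseq (m %% 2 ^ e) c) c 0 e.
rewrite foldl_rcons fE -cats1 valid_cat vE fE !size_cat size_nseq /= ck.
by split=> //; [rewrite nseqD catA mul1n | move: sz; clear; set s := size _; nia].
Qed.

Lemma run_certP k e st x : x.1 < k -> x.2 < 2 ^ e ->
  st.2 = 0 ->
  [/\ foldl (istep k) st (run_cert e x) = (st.1.1 ++ nseq x.2 x.1, x.1, 0),
      valid k st (run_cert e x) & size (run_cert e x) <= 1 + k + e * e].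
Proof.
case: st x => [[w c] i] [d m] /= dk me ->; rewrite /run_cert /=.
have [|fN vN] := @next_cert k w 0 0 d; first by rewrite add0n ltnW.
have [fB vB sB] := bits_cert w m e dk.
rewrite foldl_cat valid_cat fN vN fB vB modn_small // size_cat size_nseq.
by split=> //; lia.
Qed.

Definition start_istate : istate := ([::], 0, 0).

(** The runs given by [few_runs] are written one after the other, each of them as a
    concatenation of powers of its letter according to the binary digits of its
    length. *)
Lemma exists_cert k e w : all (gtn k) w -> size w < 2 ^ e ->
  exists z : seq (bool * bool), [/\ valid k start_istate z,
    size z <= k * (8 * (k + e).+1 ^ 2) * (1 + k + e * e) &
    forall a b, a <= k -> b < k ->
      pairs a b (foldl (istep k) start_istate z).1.1 = pairs a b w].
Proof.
move=> wk we; pose rl := [seq (c, 1) | c <- w].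
have wE : run_word rl = w by rewrite /rl /run_word; elim: (w) => //= c s ->.
have := @few_runs k e rl; rewrite wE all_map => -[//|//|rl' [sz alk pairsE]].
have me : all (fun x => x.2 < 2 ^ e) rl'.
  have : size (run_word rl') < 2 ^ e.
    rewrite -(sum_count_letters (run_word_letters alk)); rewrite -(sum_count_letters wk) in we.
    by under eq_bigr do rewrite -pairs0 pairsE // pairs0.
  rewrite /run_word; elim: (rl') => //= x r IH.
  rewrite size_cat size_nseq => H; rewrite IH ?andbT; lia.
exists (flatten [seq run_cert e x | x <- rl']).
suff H : forall st, st.2 = 0 -> let z := flatten [seq run_cert e x | x <- rl'] in
  [/\ (foldl (istep k) st z).1.1 = st.1.1 ++ run_word rl', valid k st z &
      size z <= size rl' * (1 + k + e * e)].
  have [// | fE vE sE] := H start_istate; rewrite fE /=; split=> //.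
  by apply: leq_trans sE _; rewrite leq_mul2r sz orbT.
elim: rl' alk me {sz pairsE} => [|x r IH]; first by move=> _ _ st _; rewrite /= cats0.
move=> /andP[xk rk] /andP[xe re] st st0; have [fE vE sE] := run_certP xk xe st0.
cbv zeta; rewrite (_ : flatten _ = run_cert e x ++ flatten [seq run_cert e y | y <- r]) //.
set z := flatten _; rewrite foldl_cat valid_cat size_cat fE vE.
have [//|-> -> sr] := IH rk re (st.1.1 ++ nseq x.2 x.1, x.1, 0).
by rewrite /run_word /= catA; split=> //; rewrite mulSn leq_add.
Qed.

Lemma foldl_letters k st z : all (gtn k) st.1.1 ->
  all (gtn k) (foldl (istep k) st z).1.1.
Proof.
elim: z st => //= -[x y] z IH [[w c] i] wk; apply: IH.
case: x; case: y => //=; case: ifP => //= ck.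
by rewrite all_cat all_nseq /= ck orbT andbT.
Qed.

(** * Binary numerals and the encoding of profiles *)

Fixpoint bval (s : seq bool) : nat := if s is b :: s' then b + (bval s').*2 else 0.

Lemma binary_rec n : 0 < n -> binary n = odd n :: binary n./2.
Proof.
move=> n0; rewrite /binary up_log2S // /mkseq /= divn1 (iotaDl 1) -map_comp.
by congr cons; apply: eq_map => i /=; rewrite expnS divnMA divn2.
Qed.

Lemma bval_binary n : bval (binary n) = n.
Proof.
elim/ltn_ind: n => -[|n] IH //; rewrite binary_rec // -[RHS]odd_double_half.
by rewrite -{2}(IH n.+1./2) //; lia.
Qed.

Lemma last_binary n : 0 < n -> last false (binary n).
Proof.
elim/ltn_ind: n => -[|[|n]] IH // _; rewrite binary_rec //=.
have := IH n.+2./2; rewrite binary_rec //; apply; lia.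
Qed.

Lemma bval_gt0 s : last false s -> 0 < bval s.
Proof. by elim: s => //= b [|c s] IH /=; [case: b | move=> /IH /=; lia]. Qed.

(** Numerals without leading zeros are unique; the condition on the last digit is how
    the verifier recognizes them. *)
Lemma binary_bval s : s = [::] \/ last false s -> binary (bval s) = s.
Proof.
case=> [->//|]; elim: s => //= b s IH ls.
have v0 := bval_gt0 (s := b :: s) ls; rewrite binary_rec //.
rewrite oddD odd_double addbF halfD odd_double andbF doubleK.
case: s ls IH {v0} => [|c s] /=; first by case: b.
by move=> ls /(_ ls); case: b => /= ->.
Qed.

Lemma bval_lt s : bval s < 2 ^ size s.
Proof. by elim: s => //= b s IH; rewrite expnS; case: b; lia. Qed.

Lemma ltn_binary n : n < 2 ^ size (binary n).
Proof. by rewrite -{1}(bval_binary n) bval_lt. Qed.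

Lemma scan_snd T (f g : pred T) p s w :
  (scan f g p s w).2 = s + p * count g w + (scan f g 0 0 w).2.
Proof.
elim: w p s => [|c w IH] p s /=; first by rewrite muln0 !addn0.
by rewrite IH [in RHS]IH; case: (g c); case: (f c); nia.
Qed.

Lemma occ0 (T : eqType) (w : seq T) : occ w [::] = 1.
Proof.
rewrite /occ (eq_card (B := predT)) ?card_tuple //.
by move=> t; rewrite inE tuple0.
Qed.

Lemma occ1 (T : eqType) (w : seq T) a : occ w [:: a] = count_mem a w.
Proof.
pose h (i : 'I_(size w)) : 1.-tuple 'I_(size w) := [tuple i].
have h_inj : injective h by move=> i j /(congr1 val)[].
rewrite /occ -[RHS]sum1_count (big_tnth _ _ w) sum1_card -(card_imset _ h_inj).
apply: eq_card => t; rewrite inE; apply/idP/imsetP => [|[i ia ->]] /=.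
  case: t => -[|i [|]] // st /=; rewrite eqseq_cons andbT => ia.
  by exists i; [|exact: val_inj].
by rewrite eqseq_cons andbT; exact: ia.
Qed.

Lemma sum_pairs (T : eqType) (w : seq T) a b :
  \sum_(i < size w) \sum_(j < size w)
    ((i < j) && (nth a w i == a) && (nth a w j == b)) =
  (scan (pred1 a) (pred1 b) 0 0 w).2.
Proof.
elim: w => [|c w IH] /=; first by rewrite big_ord0.
rewrite scan_snd -IH big_ord_recl; congr (_ + _).
  rewrite big_ord_recl /= muln0 !add0n -sum1_count (big_nth a) big_mkord big_distrr /=.
  rewrite [RHS]big_mkcond; apply: eq_bigr => j _.
  by case: (c == a); case: (nth a w j == b).
apply: eq_bigr => i _; rewrite big_ord_recl add0n.
by apply: eq_bigr => j _; rewrite /= !add0n ltnS.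
Qed.

(** The sets of two positions counted by [occ] are counted by the passes over the word
    that the verifier can simulate. *)
Lemma occ2 (T : eqType) (w : seq T) a b :
  occ w [:: a; b] = (scan (pred1 a) (pred1 b) 0 0 w).2.
Proof.
pose h (p : 'I_(size w) * 'I_(size w)) : 2.-tuple 'I_(size w) := [tuple p.1; p.2].
have h_inj : injective h by move=> [i j] [i' j'] /(congr1 val)[/= -> ->].
rewrite -sum_pairs pair_big /= -big_mkcond /= sum1_card -(card_imset _ h_inj).
apply: eq_card => t; rewrite inE; apply/idP/imsetP => [|[[i j] ijP ->]] /=.
  case: t => -[|i [|j []]] // st /=; rewrite andbT !eqseq_cons andbT !(tnth_nth a) /= => ijP.
  by exists (i, j); [rewrite unfold_in /= -andbA | exact: val_inj].
by move: ijP; rewrite unfold_in /= andbT !eqseq_cons andbT !(tnth_nth a) -andbA.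
Qed.

Definition number_code (n : nat) : seq (option bool) := rcons (map Some (binary n)) None.

Definition enc_row (k : nat) (w : seq nat) (a : nat) : seq (option bool) :=
  flatten [seq number_code (pairs a b w) | b <- iota 0 k].

(** The encoding of the profile of a word over the letters [0, ..., k-1]: after the
    coordinate of the empty word, row 0 lists the coordinates of the words of length 1
    and the rows [1, ..., k] those of the words of length 2. *)
Definition enc (k : nat) (w : seq nat) : seq (option bool) :=
  number_code 1 ++ flatten [seq enc_row k w a | a <- iota 0 k.+1].

Definition rank_word (Sigma : finType) (w : seq Sigma) : seq nat :=
  [seq (enum_rank a : nat) | a <- w].

Lemma pairs_rank (Sigma : finType) (w : seq Sigma) (a b : Sigma) :
  pairs (enum_rank a).+1 (enum_rank b) (rank_word w) = occ w [:: a; b].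
Proof.
rewrite occ2 /pairs scan_map; congr _.2; apply: eq_scan => c /=.
  by rewrite eqSS val_eqE (inj_eq enum_rank_inj).
by rewrite val_eqE (inj_eq enum_rank_inj).
Qed.

Lemma pairs0_rank (Sigma : finType) (w : seq Sigma) (b : Sigma) :
  pairs 0 (enum_rank b) (rank_word w) = occ w [:: b].
Proof.
rewrite occ1 pairs0 count_map; apply: eq_count => c /=.
by rewrite val_eqE (inj_eq enum_rank_inj).
Qed.

Lemma iota_enum_rank (Sigma : finType) :
  iota 0 #|Sigma| = [seq (enum_rank a : nat) | a <- enum Sigma].
Proof.
apply: (@eq_from_nth _ 0) => [|i]; rewrite size_iota; first by rewrite size_map cardT.
move=> iP.
rewrite nth_iota // add0n; have a0 := enum_val (Ordinal iP).
by rewrite (nth_map a0) -?cardE // -(enum_val_nth a0 (Ordinal iP)) enum_valK.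
Qed.

Lemma flatten_flatten (T : Type) (sss : seq (seq (seq T))) :
  flatten (flatten sss) = flatten [seq flatten ss | ss <- sss].
Proof. by elim: sss => //= ss sss IH; rewrite flatten_cat IH. Qed.

Lemma encode_profile (Sigma : finType) (w : seq Sigma) :
  encode (profile2 w) = enc #|Sigma| (rank_word w).
Proof.
rewrite /encode /words2 /= ffunE occ0 /enc; congr cat.
rewrite map_cat flatten_cat /= -map_comp; congr cat.
  rewrite /enc_row iota_enum_rank -map_comp; congr flatten; apply: eq_map => a /=.
  by rewrite ffunE pairs0_rank.
rewrite map_allpairs flatten_flatten (iotaDl 1) iota_enum_rank -!map_comp.
congr flatten; apply: eq_map => a /=.
rewrite /enc_row iota_enum_rank -!map_comp; congr flatten; apply: eq_map => b /=.
by rewrite ffunE pairs_rank.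
Qed.

(** Renaming the letters to their ranks, the alphabet can be taken to be an initial
    segment of the natural numbers, so that guessing it means guessing [k]. *)
Lemma binary_2_realizationP s : binary_2_realization s <->
  exists k w, all (gtn k) w /\ s = enc k w.
Proof.
split=> [[Sigma [_ [-> [w ->]]]]|[k [w [wk ->]]]].
  exists #|Sigma|, (rank_word w); rewrite encode_profile; split=> //.
  by rewrite all_map; apply/allP => a _ /=.
pose v : seq 'I_k := pmap insub w.
exists 'I_k, (profile2 v); split; last by exists v.
rewrite encode_profile card_ord; congr enc.
elim: w wk @v => //= c w IH /andP[ck /IH {1}->].
by rewrite insubT /= enum_rank_ord.
Qed.

(** * Rules for reasoning about executions *)

Section Rules.
Variables (K : nat) (G : finType).
Implicit Types (p q : prog K G) (s : store K G) (Q : store K G -> Prop).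

(** Partial correctness: it is what soundness of a nondeterministic verifier needs,
    as a wrong guess may only lead to a dead end. *)
Definition all_runs p s Q := forall s' n, exec p s s' n -> Q s'.

(** What completeness needs: the guesses can be made so that the execution is short. *)
Definition some_run t p s Q := exists s' n, [/\ n <= t, exec p s s' n & Q s'].

(** The guess of a bit. Guessing a symbol and then popping it reads the symbol. *)
Definition any (f : bool -> prog K G) := Alt (f false) (f true).

Lemma all_runs_mono p s Q Q' : all_runs p s Q -> (forall s', Q s' -> Q' s') -> all_runs p s Q'.
Proof. by move=> H QQ s' n /H /QQ. Qed.

Lemma all_runs_skip s Q : Q s -> all_runs (Skip K G) s Q.
Proof. by move=> H s' n e; inversion e; subst. Qed.

Lemma all_runs_push i a s Q : Q (upd s i (a :: s i)) -> all_runs (Push i a) s Q.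
Proof. by move=> H s' n e; inversion e; subst. Qed.

Lemma all_runs_pop i a s Q : (forall l, s i = a :: l -> Q (upd s i l)) -> all_runs (Pop i a) s Q.
Proof. by move=> H s' n e; inversion e; subst; apply: H. Qed.

Lemma all_runs_empty i s Q : (s i = [::] -> Q s) -> all_runs (@Empty K G i) s Q.
Proof. by move=> H s' n e; inversion e; subst; apply: H. Qed.

Lemma all_runs_seq p q s Q : all_runs p s (fun s1 => all_runs q s1 Q) -> all_runs (Seq p q) s Q.
Proof.
move=> H s' n e; have [s1 [n1 [n2 [e1 e2]]]] : exists s1 n1 n2,
    exec p s s1 n1 /\ exec q s1 s' n2.
  by inversion e; subst; do 3!eexists; split; eassumption.
exact: H e1 _ _ e2.
Qed.

Lemma all_runs_alt p q s Q : all_runs p s Q -> all_runs q s Q -> all_runs (Alt p q) s Q.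
Proof.
move=> H1 H2 s' n e.
have [m [/H1|/H2]] // : exists m, exec p s s' m \/ exec q s s' m.
by inversion e; subst; eexists; [left | right]; eassumption.
Qed.

Lemma all_runs_any f s Q : (forall b, all_runs (f b) s Q) -> all_runs (any f) s Q.
Proof. by move=> H; apply: all_runs_alt. Qed.

Lemma all_runs_star (I : store K G -> Prop) p s Q :
  I s -> (forall s1, I s1 -> all_runs p s1 I) -> (forall s1, I s1 -> Q s1) ->
  all_runs (Star p) s Q.
Proof.
move=> Is Ip IQ.
have main r s1 s2 n : exec r s1 s2 n -> r = Star p -> I s1 -> I s2.
  elim=> {r s1 s2 n} // q s1 s2 s3 n1 n2 e1 _ _ IH [qp] I1.
  by apply: IH; rewrite ?qp //; apply: (Ip _ I1 _ n1); rewrite -qp.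
by move=> s' n /main /(_ erefl Is) /IQ.
Qed.

Lemma all_runs_frame p s Q :
  all_runs p s (fun s' => (forall l, ~~ touch p l -> s' l = s l) -> Q s') -> all_runs p s Q.
Proof. by move=> H s' n e; apply: (H _ _ e) => l; apply: exec_frame e. Qed.

Lemma some_run_mono p s Q Q' t t' : some_run t p s Q -> t <= t' ->
  (forall s', Q s' -> Q' s') -> some_run t' p s Q'.
Proof.
move=> [s' [n [nt e q]]] tt QQ; exists s', n; split=> //; last exact: QQ.
exact: leq_trans tt.
Qed.

Lemma some_run_le p s Q t t' : some_run t p s Q -> t <= t' -> some_run t' p s Q.
Proof. by move=> H tt; apply: some_run_mono H tt _. Qed.

(** This spares the completeness proofs from establishing again what the soundness
    proofs say about the final stacks; it remains to bound lengths and times. *)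
Lemma some_and_all_runs p s Q Q' t : some_run t p s Q -> all_runs p s Q' ->
  some_run t p s (fun s' => Q s' /\ Q' s').
Proof. by move=> [s' [n [nt e q]]] H; exists s', n; split=> //; split=> //; apply: H e. Qed.

Lemma some_run_frame p s Q t :
  some_run t p s (fun s' => (forall l, ~~ touch p l -> s' l = s l) -> Q s') -> some_run t p s Q.
Proof.
by move=> [s' [n [nt e q]]]; exists s', n; split=> //; apply: q => l; apply: exec_frame e.
Qed.

Lemma some_run_skip s Q : Q s -> some_run 1 (Skip K G) s Q.
Proof. by exists s, 1; split=> //; constructor. Qed.

Lemma some_run_push i a s Q : Q (upd s i (a :: s i)) -> some_run 2 (Push i a) s Q.
Proof. by exists (upd s i (a :: s i)), 2; split=> //; constructor. Qed.

Lemma some_run_pop i a l s Q : s i = a :: l -> Q (upd s i l) -> some_run 1 (Pop i a) s Q.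
Proof. by exists (upd s i l), 1; split=> //; constructor. Qed.

Lemma some_run_empty i s Q : s i = [::] -> Q s -> some_run 1 (@Empty K G i) s Q.
Proof. by exists s, 1; split=> //; constructor. Qed.

Lemma some_run_seq t1 t2 p q s Q :
  some_run t1 p s (fun s1 => some_run t2 q s1 Q) -> some_run (t1 + t2).+1 (Seq p q) s Q.
Proof.
move=> [s1 [n1 [nt1 e1 [s2 [n2 [nt2 e2 q2]]]]]]; exists s2, (n1 + n2).+1.
by split=> //; [rewrite ltnS leq_add | exact: ExSeq e1 e2].
Qed.

Lemma some_run_altl t p q s Q : some_run t p s Q -> some_run t.+1 (Alt p q) s Q.
Proof. by move=> [s1 [n [nt e q1]]]; exists s1, n.+1; split=> //; exact: ExAltl. Qed.

Lemma some_run_altr t p q s Q : some_run t q s Q -> some_run t.+1 (Alt p q) s Q.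
Proof. by move=> [s1 [n [nt e q1]]]; exists s1, n.+1; split=> //; exact: ExAltr. Qed.

Lemma some_run_any t b f s Q : some_run t (f b) s Q -> some_run t.+1 (any f) s Q.
Proof. by case: b; [apply: some_run_altr | apply: some_run_altl]. Qed.

Lemma some_run_stop p s Q : Q s -> some_run 1 (Star p) s Q.
Proof. by exists s, 1; split=> //; constructor. Qed.

Lemma some_run_iter t1 t2 p s Q :
  some_run t1 p s (fun s1 => some_run t2 (Star p) s1 Q) -> some_run (t1 + t2).+1 (Star p) s Q.
Proof.
move=> [s1 [n1 [nt1 e1 [s2 [n2 [nt2 e2 q2]]]]]]; exists s2, (n1 + n2).+1.
by split=> //; [rewrite ltnS leq_add | exact: ExIter e1 e2].
Qed.

(** The invariant is indexed by the number of iterations that remain. *)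
Lemma some_run_loop (I : nat -> store K G -> Prop) t p s n :
  I n s -> (forall m s1, m < n -> I m.+1 s1 -> some_run t p s1 (I m)) ->
  some_run (n * t.+1).+1 (Star p) s (I 0).
Proof.
elim: n s => [|n IH] s Is H; first exact: some_run_stop.
rewrite mulSn addSn -addnS; apply: some_run_iter.
apply: (some_run_mono (H n s _ Is)) => // s1 I1; apply: IH => // m s2 mn.
by apply: H; rewrite ltnW.
Qed.

End Rules.

Notation "p ;; q" := (Seq p q) (at level 60, right associativity).

(** * Arithmetic on stacks *)

(** The input symbols, and pairs of bits for all other purposes. The bits of the
    numbers computed are represented as in the input. *)
Definition sym : finType := (option bool + bool * bool)%type.
Definition bit (b : bool) : sym := inl (Some b).
Definition stop : sym := inl None.
Definition mark (x : bool * bool) : sym := inr x.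

Local Notation register := 'I_12.
Local Notation program := (prog 11 sym).
Local Notation memory := (store 11 sym).

(** The input [rI]; the certificate [rZ] and a list of marks [rL], each with a stack
    ([rZ2] and [rL2]) for the part already traversed; the numbers [rP], [rS], [rD], [rU]
    and [rV], whose meaning is given by [pass_inv] below; a scratch stack [rT] and the
    carry [rC]. *)
Definition rI : register := ord0.
Definition rZ : register := @Ordinal 12 1 isT.
Definition rZ2 : register := @Ordinal 12 2 isT.
Definition rL : register := @Ordinal 12 3 isT.
Definition rL2 : register := @Ordinal 12 4 isT.
Definition rP : register := @Ordinal 12 5 isT.
Definition rS : register := @Ordinal 12 6 isT.
Definition rD : register := @Ordinal 12 7 isT.
Definition rU : register := @Ordinal 12 8 isT.
Definition rV : register := @Ordinal 12 9 isT.
Definition rT : register := @Ordinal 12 10 isT.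
Definition rC : register := @Ordinal 12 11 isT.

(** The least significant digit is on the top, so pushing a zero doubles the value. *)
Definition stack_value (l : seq sym) : nat := bval [seq x == bit true | x <- l].

Lemma stack_value_cons b l : stack_value (bit b :: l) = b + (stack_value l).*2.
Proof. by case: b. Qed.

Definition is_bit (x : sym) : bool := if x is inl (Some _) then true else false.

(** Numbers may have superfluous zeros: values give no bound on heights, so the latter are
    tracked separately. *)
Definition bit_stack (B : nat) (l : seq sym) : bool := all is_bit l && (size l <= B).

(** The empty stack has the value 0, hence the lowest digit 0. *)
Definition pop0 (i : register) (b : bool) : program :=
  if b then Pop i (bit true) else Alt (Pop i (bit false)) (@Empty 11 sym i).

Lemma all_runs_pop0 i (b : bool) s (Q : memory -> Prop) :
  (forall s1, (forall l, l != i -> s1 l = s l) ->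
     stack_value (s i) = b + (stack_value (s1 i)).*2 -> Q s1) ->
  all_runs (pop0 i b) s Q.
Proof.
move=> H; rewrite /pop0; case: b H => H.
  apply: all_runs_pop => l sl; apply: H => [j /negbTE ji|]; rewrite /upd ?ji // eqxx sl.
  by [].
apply: all_runs_alt.
  apply: all_runs_pop => l sl; apply: H => [j /negbTE ji|]; rewrite /upd ?ji // eqxx sl.
  by [].
by apply: all_runs_empty => sl; apply: H => //; rewrite sl.
Qed.

Definition low_bit (l : seq sym) : bool := if l is inl (Some b) :: _ then b else false.

Lemma some_run_pop0 i B s : bit_stack B (s i) ->
  some_run 2 (pop0 i (low_bit (s i))) s
    (fun s1 => (forall l, l != i -> s1 l = s l) /\ bit_stack B.-1 (s1 i)).
Proof.
move=> /andP[si sB]; case E: (s i) si sB => [|[[b|]|] l] //= lb lB.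
  by apply: some_run_altr; apply: some_run_empty => //; rewrite E /bit_stack.
have H : (forall j, j != i -> upd s i l j = s j) /\ bit_stack B.-1 (upd s i l i).
  by split=> [j /negbTE ji|]; rewrite /upd ?ji // eqxx /bit_stack lb /=; case: (B) lB.
case: b E => E; first by apply: (@some_run_le _ _ _ _ _ 1) => //; exact: some_run_pop E H.
by apply: some_run_altl; exact: some_run_pop E H.
Qed.

(** Binary addition of [j] to [i]. The digits of the sum are obtained in reverse order
    on [rT], paired with those of [j], which are thus restored at the same time. *)
Definition ADD (i j : register) : program :=
  Push rC (bit false) ;;
  Star (any (fun a => any (fun b => any (fun c =>
    Pop rC (bit c) ;; pop0 i a ;; pop0 j b ;; Push rT (mark (a (+) b (+) c, b)) ;;
    Push rC (bit (a && b || c && (a || b))))))) ;;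
  @Empty 11 sym i ;; @Empty 11 sym j ;; Pop rC (bit false) ;;
  Star (any (fun x => any (fun y =>
    Pop rT (mark (x, y)) ;; Push i (bit x) ;; Push j (bit y)))) ;;
  @Empty 11 sym rT.

(** The value of a stack of value [x] after the bits [f m], for [m] in [l], have been
    pushed on it. Keeping it invariant avoids talking about reversed numerals. *)
Definition unwind_value (f : bool * bool -> bool) (x : nat) (l : seq (bool * bool)) :=
  foldl (fun x m => f m + x.*2) x l.

Definition marks (l : seq (bool * bool)) : seq sym := map mark l.

Lemma marks_cons m l l' : marks l = mark m :: l' -> exists2 l1, l = m :: l1 & l' = marks l1.
Proof. by case: l => [|m1 l] //= [-> <-]; exists l. Qed.

Lemma all_runs_ADD i j s : uniq [:: i; j; rT; rC] -> s rT = [::] ->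
  all_runs (ADD i j) s (fun s' => [/\ stack_value (s' i) = stack_value (s i) + stack_value (s j),
    stack_value (s' j) = stack_value (s j) & s' rT = [::]]).
Proof.
rewrite /= !inE !negb_or !andbT => /andP[/and3P[ij iT iC] /andP[jT jC]] sT.
have E := (negbTE ij, negbTE iT, negbTE iC, negbTE jT, negbTE jC).
have F : (j == i = false) * (rT == i = false) * (rC == i = false) * (rT == j = false) *
   (rC == j = false) by rewrite ![rT == _]eq_sym ![rC == _]eq_sym [j == i]eq_sym !E.
pose loop_inv (s1 : memory) := exists T1 c C0, [/\ s1 rT = marks T1, s1 rC = bit c :: C0,
  unwind_value fst (stack_value (s1 i) + stack_value (s1 j) + c) T1 = stack_value (s i) +
    stack_value (s j) &
  unwind_value snd (stack_value (s1 j)) T1 = stack_value (s j)].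
pose unwind_inv (s1 : memory) := exists T1, [/\ s1 rT = marks T1,
  unwind_value fst (stack_value (s1 i)) T1 = stack_value (s i) + stack_value (s j) &
  unwind_value snd (stack_value (s1 j)) T1 = stack_value (s j)].
apply: all_runs_seq; apply: all_runs_push; apply: all_runs_seq;
  apply: (@all_runs_star _ _ loop_inv).
- by exists [::], false, (s rC); rewrite /upd !E sT /= addn0.
- move=> s1 [T1 [c [C0 [T1E C1E u1 u2]]]]; apply: all_runs_any => a.
  apply: all_runs_any => b; apply: all_runs_any => c1.
  apply: all_runs_seq; apply: all_runs_pop => l; rewrite C1E => -[cE lE]; subst c1 l.
  apply: all_runs_seq; apply: all_runs_pop0 => s2 f2; rewrite /upd !E => g2.
  apply: all_runs_seq; apply: all_runs_pop0 => s3 f3; rewrite f2 ?F // /upd !E => g3.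
  apply: all_runs_seq; apply: all_runs_push; apply: all_runs_push; rewrite /upd /=.
  set m := (_, _); set c' := _ || _.
  exists (m :: T1), c', C0; rewrite !E /= f3 1?eq_sym // f2 1?eq_sym // /upd /= T1E.
  rewrite f3 1?eq_sym // f2 1?eq_sym // /upd /=; split=> //.
  + rewrite f3 // -u1; congr (unwind_value _ _ T1); rewrite g2 g3 /m /c' /=.
    by clear; case: a; case: b; case: c; rewrite /=; lia.
  + by rewrite -u2 g3.
- move=> s1 [T1 [c [C0 [T1E C1E u1 u2]]]].
  apply: all_runs_seq; apply: all_runs_empty => i0; apply: all_runs_seq;
    apply: all_runs_empty => j0.
  apply: all_runs_seq; apply: all_runs_pop => l; rewrite C1E => -[cE _]; rewrite {c}cE in C1E u1.
  rewrite i0 j0 in u1 u2; apply: all_runs_seq; apply: (@all_runs_star _ _ unwind_inv).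
  + by exists T1; rewrite /upd !E /= i0 j0.
  + move=> s2 [T2 [T2E v1 v2]]; apply: all_runs_any => x; apply: all_runs_any => y.
    apply: all_runs_seq; apply: all_runs_pop => l2; rewrite T2E => /marks_cons[T3 TE ->];
      subst T2.
    apply: all_runs_seq; apply: all_runs_push; apply: all_runs_push; exists T3;
      rewrite /upd !E /= !F !eqxx.
    by rewrite !stack_value_cons; split.
  + move=> s2 [T2 [T2E v1 v2]]; apply: all_runs_empty => T0.
    by rewrite T0 in T2E; case: T2 T2E v1 v2.
Qed.

Lemma bit_stack0 l : bit_stack 0 l -> l = [::].
Proof. by case: l => // x l /andP[]. Qed.

Lemma bit_stack_le B B' l : bit_stack B l -> B <= B' -> bit_stack B' l.
Proof. by rewrite /bit_stack => /andP[-> lB] /(leq_trans lB)->. Qed.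

Lemma bit_stack_cons B b l : bit_stack B l -> bit_stack B.+1 (bit b :: l).
Proof. by []. Qed.

Lemma some_run_ADD i j B s : uniq [:: i; j; rT; rC] -> s rT = [::] ->
  bit_stack B (s i) -> bit_stack B (s j) ->
  some_run (40 * B + 80) (ADD i j) s (fun s' => bit_stack B.+1 (s' i) /\ bit_stack B.+1 (s' j)).
Proof.
rewrite /= !inE !negb_or !andbT => /andP[/and3P[ij iT iC] /andP[jT jC]] sT ni nj.
have E := (negbTE ij, negbTE iT, negbTE iC, negbTE jT, negbTE jC).
have F : (j == i = false) * (rT == i = false) * (rC == i = false) * (rT == j = false) *
   (rC == j = false) by rewrite ![rT == _]eq_sym ![rC == _]eq_sym [j == i]eq_sym !E.
pose I1 m (s1 : memory) := [/\ bit_stack m.-1 (s1 i), bit_stack m.-1 (s1 j) &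
  exists T1 c C0, [/\ s1 rT = marks T1, size T1 + m = B.+1, s1 rC = bit c :: C0 &
    m = 0 -> c = false]].
pose I2 m (s1 : memory) := [/\ bit_stack (B.+1 - m) (s1 i), bit_stack (B.+1 - m) (s1 j) &
  exists T1, s1 rT = marks T1 /\ size T1 = m].
eapply some_run_le.
  apply: some_run_seq; apply: some_run_push; apply: some_run_seq.
  apply: (some_run_mono (@some_run_loop _ _ I1 20 _ _ B.+1 _ _)) => //.
  - by split; rewrite /upd ?E //; exists [::], false, (s rC); rewrite sT.
  - move=> m s1 mB [mi mj [T1 [c [C0 [T1E sz C1E _]]]]].
    eapply some_run_le.
      apply: (@some_run_any _ _ _ (low_bit (s1 i)));
        apply: (@some_run_any _ _ _ (low_bit (s1 j))).
      apply: (@some_run_any _ _ _ c); apply: some_run_seq; apply: some_run_pop; first exact: C1E.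
      set s2 := upd _ _ _; have iE : s2 i = s1 i by rewrite /s2 /upd E.
      have jE : s2 j = s1 j by rewrite /s2 /upd E.
      rewrite -iE -jE in mi mj *; apply: some_run_seq.
      apply: (some_run_mono (some_run_pop0 mi)) => // s3 [f3 n3].
      have j3 : s2 j = s3 j by rewrite f3 ?F // eq_sym.
      rewrite j3 in mj *; apply: some_run_seq;
        apply: (some_run_mono (some_run_pop0 mj)) => // s4 [f4 n4].
      apply: some_run_seq; apply: some_run_push; apply: some_run_push; rewrite /upd /=.
      split; [by rewrite !E f4 | by rewrite !E |]; set m' := (_, _); set c' := _ || _.
      exists (m' :: T1), c', C0; rewrite /= ?f4 1?eq_sym // ?f3 1?eq_sym //.
      rewrite /s2 /upd /= T1E; split=> //; first by rewrite addSnnS.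
      by move=> m0; rewrite /c'; move: mi mj; rewrite m0 => /bit_stack0-> /bit_stack0-> /=;
        rewrite andbF.
    by [].
  - move=> s1 [/= /bit_stack0 i0 /bit_stack0 j0 [T1 [c [C0 [T1E sz C1E c0]]]]].
    apply: some_run_seq; apply: some_run_empty => //; apply: some_run_seq;
      apply: some_run_empty => //.
    apply: some_run_seq; apply: some_run_pop; first by rewrite C1E c0.
    apply: some_run_seq; apply: (some_run_mono (@some_run_loop _ _ I2 10 _ _ B.+1 _ _)) => //.
    + by split; rewrite /upd ?E /= ?i0 ?j0 //; exists T1; rewrite -sz addn0.
    + move=> m s2 mB [mi mj [T2 [T2E sz2]]]; case: T2 T2E sz2 => // -[x y] T2 T2E [sz2].
      eapply some_run_le.
        apply: (@some_run_any _ _ _ x); apply: (@some_run_any _ _ _ y).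
        apply: some_run_seq; apply: some_run_pop; first exact: T2E.
        apply: some_run_seq; apply: some_run_push; apply: some_run_push.
        have sB : B.+1 - m = (B.+1 - m.+1).+1 by lia.
        split; rewrite /upd !E ?F !eqxx ?sB; [exact: bit_stack_cons | exact: bit_stack_cons |].
        by exists T2.
      by [].
    + move=> s2; rewrite /I2 subn0 => -[ni2 nj2 [T2 [T2E /size0nil T20]]].
      by apply: some_run_empty; rewrite ?T2E ?T20.
lia.
Qed.

(** * Checking one coordinate *)

(** Reverses [i] onto [j]. This rewinds the stacks that were traversed. *)
Definition MOVE (i j : register) : program :=
  Star (any (fun x => any (fun y => Pop i (mark (x, y)) ;; Push j (mark (x, y))))) ;;
  @Empty 11 sym i.

Lemma all_runs_MOVE i j s : i != j ->
  all_runs (MOVE i j) s (fun s' => s' i = [::] /\ s' j = catrev (s i) (s j)).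
Proof.
move=> ij; have ji := ij; rewrite eq_sym in ji.
apply: all_runs_seq; apply: (@all_runs_star _ _ (fun s1 : memory =>
  catrev (s1 i) (s1 j) = catrev (s i) (s j))) => // s1.
  move=> E; apply: all_runs_any => x; apply: all_runs_any => y.
  apply: all_runs_seq; apply: all_runs_pop => l si; apply: all_runs_push.
  by rewrite /upd !eqxx (negbTE ij) (negbTE ji) -E si.
by move=> E; apply: all_runs_empty => i0; rewrite -E i0.
Qed.

Lemma some_run_MOVE i j s l : i != j -> s i = marks l ->
  some_run (8 * size l + 8) (MOVE i j) s (fun s' => True).
Proof.
move=> ij sl; pose I1 m (s1 : memory) := exists2 l1, s1 i = marks l1 & size l1 = m.
eapply some_run_le.
  apply: some_run_seq; apply: (some_run_mono (@some_run_loop _ _ I1 6 _ _ (size l) _ _)) => //.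
  - by exists l.
  - move=> m s1 _ [[|[x y] l1] // l1E [sz]]; eapply some_run_le.
      apply: (@some_run_any _ _ _ x); apply: (@some_run_any _ _ _ y).
      apply: some_run_seq; apply: some_run_pop; first exact: l1E.
      by apply: some_run_push; exists l1; rewrite // /upd (negbTE ij) eqxx.
    by [].
  - by move=> s1 [l1 l1E /size0nil l10]; apply: some_run_empty; rewrite // l1E l10.
lia.
Qed.

Definition CLEAR (i : register) : program :=
  Star (any (fun b => Pop i (bit b))) ;; @Empty 11 sym i.

Lemma all_runs_CLEAR i s : all_runs (CLEAR i) s (fun s' => s' i = [::]).
Proof.
apply: all_runs_seq; apply: (@all_runs_star _ _ (fun _ => True)) => // s1 _.
by apply: all_runs_empty.
Qed.

Lemma some_run_CLEAR i s B : bit_stack B (s i) ->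
  some_run (3 * B + 5) (CLEAR i) s (fun s' => s' i = [::]).
Proof.
move=> ni; pose I1 m (s1 : memory) := bit_stack B (s1 i) /\ size (s1 i) = m.
eapply some_run_le.
  apply: some_run_seq; apply: (some_run_mono (@some_run_loop _ _ I1 2 _ _ (size (s i)) _ _)) =>
    //.
  - move=> m s1 _ [n1 sz].
    have [b [l [E nl]]] : exists b l, s1 i = bit b :: l /\ bit_stack B l.
      case/andP: n1; case: (s1 i) sz => [|[[b|]|] l] //= _ lb lB.
      by exists b, l; rewrite /bit_stack lb ltnW.
    apply: (@some_run_any _ _ 1 b); apply: (some_run_pop E).
    by rewrite /I1 /upd eqxx; split=> //; move: sz; rewrite E => -[].
  - by move=> s1 [n1 /size0nil E]; apply: some_run_empty.
by case/andP: ni => _ sB; lia.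
Qed.

(** What the verifier does after a power has been appended: [rD := rP], [rU := 1] and
    [rV := m]. *)
Definition RESET (m : bool) : program :=
  CLEAR rD ;; ADD rD rP ;; CLEAR rU ;; Push rU (bit true) ;;
  CLEAR rV ;; Push rV (bit m).

Lemma all_runs_RESET m s : s rT = [::] ->
  all_runs (RESET m) s (fun s' => [/\ stack_value (s' rD) = stack_value (s rP),
    stack_value (s' rP) = stack_value (s rP),
    stack_value (s' rU) = 1, stack_value (s' rV) = m & s' rT = [::]]).
Proof.
move=> T0; apply: all_runs_seq; apply: all_runs_frame;
  apply: (all_runs_mono (@all_runs_CLEAR _ _)) => s1 D1 f1.
apply: all_runs_seq; apply: all_runs_frame.
apply: (all_runs_mono (all_runs_ADD (i := rD) (j := rP) isT _)) => [|s2 [D2 P2 T2] f2].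
  by rewrite f1.
apply: all_runs_seq; apply: all_runs_frame;
  apply: (all_runs_mono (@all_runs_CLEAR _ _)) => s3 U3 f3.
apply: all_runs_seq; apply: all_runs_push.
apply: all_runs_seq; apply: all_runs_frame;
  apply: (all_runs_mono (@all_runs_CLEAR _ _)) => s4 V4 f4.
have D4 : stack_value (s4 rD) = stack_value (s rP) by rewrite f4 // /upd /= f3 // D2 D1 f1.
have P4 : stack_value (s4 rP) = stack_value (s rP) by rewrite f4 // /upd /= f3 // P2 f1.
have U4 : stack_value (s4 rU) = 1 by rewrite f4 // /upd /= U3.
have T4 : s4 rT = [::] by rewrite f4 // /upd /= f3.
by apply: all_runs_push; rewrite /upd /= V4 stack_value_cons addn0; split.
Qed.

Lemma some_run_RESET m s B B' : s rT = [::] -> bit_stack B (s rP) -> bit_stack B' (s rD) ->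
  bit_stack B' (s rU) ->
  bit_stack B' (s rV) ->
  some_run (40 * B + 9 * B' + 150) (RESET m) s (fun s' =>
    [/\ bit_stack B.+1 (s' rD), bit_stack B.+1 (s' rP),
     bit_stack B.+1 (s' rU) & bit_stack B.+1 (s' rV)]).
Proof.
move=> T0 nP nD nU nV; eapply some_run_le.
  apply: some_run_seq; apply: some_run_frame;
    apply: (some_run_mono (some_run_CLEAR nD)) => // s1 D1 f1.
  apply: some_run_seq; apply: some_run_frame.
  apply: (some_run_mono (some_run_ADD (i := rD) (j := rP) (B := B) isT _ _ _));
    rewrite ?D1 ?f1 //.
  move=> s2 [D2 P2] f2; apply: some_run_seq; apply: some_run_frame.
  have U2 : bit_stack B' (s2 rU) by rewrite f2 // f1.
  apply: (some_run_mono (some_run_CLEAR U2)) => // s3 U3 f3.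
  apply: some_run_seq; apply: some_run_push.
  set s4 := upd _ _ _; have V4 : bit_stack B' (s4 rV) by rewrite /s4 /upd /= f3 // f2 // f1.
  apply: some_run_seq; apply: some_run_frame;
    apply: (some_run_mono (some_run_CLEAR V4)) => // s5 V5 f5.
  have E5 : [/\ bit_stack B.+1 (s5 rD), bit_stack B.+1 (s5 rP) & bit_stack B.+1 (s5 rU)].
    by split; rewrite f5 // /s4 /upd /= ?U3 ?f3.
  by have [D5 P5 U5] := E5; apply: some_run_push; rewrite /upd /= V5; split.
lia.
Qed.

(** The effect of the four commands of [istep] on the counts of the pairs [(a, b)]. The
    position between [rL2] and [rL] is the current letter, and the mark found there tells
    whether this letter is that of row [a] and whether it is [b]. The argument [m] tells
    whether [a = b.+1]. *)
Definition COMMAND (m u v : bool) : program :=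
  match u, v with
  | false, false =>
      any (fun x => any (fun y => Pop rL (mark (x, y)) ;; Push rL2 (mark (x, y))))
  | false, true => MOVE rL2 rL
  | true, false =>
      Push rD (bit false) ;; ADD rD rV ;; Push rV (bit false) ;; Push rV (bit false) ;;
      Push rU (bit false)
  | true, true =>
      any (fun x => any (fun y =>
        Pop rL (mark (x, y)) ;; Push rL (mark (x, y)) ;;
        (if y then ADD rS rD else Skip 11 sym) ;; (if x then ADD rP rU else Skip 11 sym) ;;
        RESET m))
  end.

(** Pointer and marks together replace comparisons of letters, of which there are
    unboundedly many. An index out of range ([a = 0] or [b = k]) marks nothing. *)
Definition marking k a b : seq (bool * bool) := [seq (j.+1 == a, j == b) | j <- iota 0 k].

Lemma drop_marking k a b c m l : drop c (marking k a b) = m :: l ->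
  [/\ c < k, m = (c.+1 == a, c == b) & l = drop c.+1 (marking k a b)].
Proof.
move=> E; have ck : c < k.
  by have := congr1 size E; rewrite size_drop size_map size_iota /=; lia.
by move: E; rewrite (drop_nth (false, false)) ?size_map ?size_iota // => -[<- <-];
   rewrite (nth_map 0) ?size_iota // nth_iota.
Qed.

Lemma drop_marking_cons k a b c : c < k ->
  drop c (marking k a b) = (c.+1 == a, c == b) :: drop c.+1 (marking k a b).
Proof.
move=> ck; rewrite (drop_nth (false, false)) ?size_map ?size_iota //.
by rewrite (nth_map 0) ?size_iota // nth_iota.
Qed.

(** Appending the current power of a letter [c] with [c = b] adds to the pairs [(a, b)]
    the number [rD]. Its second term is present only if [a = b.+1] and counts the pairs
    inside the power; incrementing the exponent amounts to [rD := 2 * rD + rV], as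
    ['C(2 * n, 2) = 2 * 'C(n, 2) + n ^ 2] for [n = 2 ^ i], where [rV] is [n ^ 2] or 0. *)
Definition pass_inv k a b (st : istate) (s : memory) : Prop :=
  let: (w, c, i) := st in
  [/\ s rT = [::], c <= k /\ s rL2 = marks (rev (take c (marking k a b))) /\
        s rL = marks (drop c (marking k a b)),
      stack_value (s rP) = row_letters a w, stack_value (s rS) = pairs a b w &
  [/\ stack_value (s rD) = row_letters a w * 2 ^ i + (a == b.+1) * 'C(2 ^ i, 2),
      stack_value (s rU) = 2 ^ i & stack_value (s rV) = (a == b.+1) * 4 ^ i]].

Lemma take_marking k a b c : c < k ->
  take c.+1 (marking k a b) = rcons (take c (marking k a b)) (c.+1 == a, c == b).
Proof.
move=> ck; rewrite (take_nth (false, false)) ?size_map ?size_iota //.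
by rewrite (nth_map 0) ?size_iota // nth_iota.
Qed.

Lemma bin_double n : 'C(2 * n, 2) = 2 * 'C(n, 2) + n * n.
Proof.
elim: n => // n IH; rewrite mulnS !addSn add0n !binS !bin0 !bin1 IH; lia.
Qed.

Definition ADD_IF (y : bool) (i j : register) : program := if y then ADD i j else Skip 11 sym.

(** For abstract [i] and [j], [touch] does not evaluate. *)
Lemma touch_ADD i j l : l \notin [:: i; j; rT; rC] -> ~~ touch (ADD i j) l.
Proof.
rewrite !inE !negb_or => /and4P[/negbTE li /negbTE lj /negbTE lT /negbTE lC].
by rewrite /ADD /pop0 /= !(li, lj, lT, lC).
Qed.

Lemma all_runs_ADD_IF y i j s : uniq [:: i; j; rT; rC] -> s rT = [::] ->
  all_runs (ADD_IF y i j) s (fun s' =>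
    [/\ stack_value (s' i) = stack_value (s i) + y * stack_value (s j),
    stack_value (s' j) = stack_value (s j), s' rT = [::] &
    forall l, l \notin [:: i; j; rT; rC] -> s' l = s l]).
Proof.
move=> uq T0; rewrite /ADD_IF; case: y; last by apply: all_runs_skip; rewrite addn0; split.
apply: all_runs_frame; apply: (all_runs_mono (all_runs_ADD uq T0)) => s1 [E1 E2 T1] f1.
by rewrite mul1n; split=> // l lE; apply/f1/touch_ADD.
Qed.

Lemma some_run_ADD_IF y i j B s : uniq [:: i; j; rT; rC] -> s rT = [::] ->
  bit_stack B (s i) -> bit_stack B (s j) ->
  some_run (40 * B + 80) (ADD_IF y i j) s (fun s' =>
    [/\ bit_stack B.+1 (s' i), bit_stack B.+1 (s' j),
    s' rT = [::] & forall l, l \notin [:: i; j; rT; rC] -> s' l = s l]).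
Proof.
move=> uq T0 ni nj; rewrite /ADD_IF; case: y; last first.
  apply: (some_run_le (t := 1)); last by lia.
  by apply: some_run_skip; split=> //;
    [exact: bit_stack_le ni (leqnSn B) | exact: bit_stack_le nj (leqnSn B)].
apply: some_run_frame; have := some_and_all_runs (some_run_ADD uq T0 ni nj) (all_runs_ADD uq T0).
move/some_run_mono; apply=> // s1 [[n1 n2] [_ _ T1]] f1.
by split=> // l lE; apply/f1/touch_ADD.
Qed.

(** A stack whose top is popped and pushed back is unchanged, but the two memories are
    equal only pointwise. *)
Lemma peekE (s : memory) (r : register) x l : s r = x :: l ->
  forall l', upd (upd s r l) r (x :: upd s r l r) l' = s l'.
Proof.
by move=> E l'; rewrite /upd eqxx; case: eqP => [->|//]; rewrite E.
Qed.

Lemma all_runs_COMMAND k a b st u v s : pass_inv k a b st s ->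
  all_runs (COMMAND (a == b.+1) u v) s (pass_inv k a b (istep k st (u, v))).
Proof.
case: st => [[w c] i] [T0 [ck [L2E LE]] PE SE [DE UE VE]].
case: u; case: v => /=.
- apply: all_runs_any => x; apply: all_runs_any => y.
  apply: all_runs_seq; apply: all_runs_pop => l lE; apply: all_runs_seq; apply: all_runs_push.
  have [l1 l1E _] : exists2 l1, drop c (marking k a b) = (x, y) :: l1 & l = marks l1.
    by apply: marks_cons; rewrite -LE.
  have [lt_ck [xE yE] _] := drop_marking l1E; rewrite lt_ck.
  have := peekE lE; set s1 := upd _ _ _ => E1.
  apply: all_runs_seq; apply: (all_runs_mono (@all_runs_ADD_IF y rS rD s1 _ _)) => //.
  move=> s2 [S2 D2 T2 f2].
  apply: all_runs_seq; apply: (all_runs_mono (@all_runs_ADD_IF x rP rU s2 _ _)) =>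
    // s3 [P3 U3 T3 f3].
  apply: all_runs_frame; apply: (all_runs_mono (@all_runs_RESET _ _ T3)) =>
    // s4 [D4 P4 U4 V4 T4] f4.
  have PF : stack_value (s3 rP) = row_letters a (w ++ nseq (2 ^ i) c).
    by rewrite P3 !f2 // !E1 PE UE row_letters_cat_nseq xE.
  split=> //; rewrite ?P4 ?D4 ?PF //.
  + by rewrite !f4 // !f3 // !f2 // !E1.
  + rewrite f4 // f3 // S2 !E1 SE DE pairs_cat_nseq yE; case: (eqVneq c b) => [->|_] //.
    by rewrite [b.+1 == _]eq_sym; lia.
  + by split; rewrite ?U4 ?V4 ?expn0 ?muln1 ?muln0 ?addn0.
- apply: all_runs_seq; apply: all_runs_push; apply: all_runs_seq; apply: all_runs_frame.
  set s1 := upd _ _ _; apply: (all_runs_mono (@all_runs_ADD rD rV s1 _ _)) => // s2 [D2 V2 T2] f2.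
  do 2!(apply: all_runs_seq; apply: all_runs_push); apply: all_runs_push.
  split; rewrite /upd /= //; [by rewrite !f2 | by rewrite f2 | by rewrite f2 |].
  rewrite (f2 rU) // !(stack_value_cons, D2,
    V2) /s1 /upd /= ?stack_value_cons DE UE VE !expnS bin_double; split; try lia.
  by rewrite (_ : 4 = 2 * 2) // expnMn; lia.
- apply: all_runs_frame; apply: (all_runs_mono (@all_runs_MOVE rL2 rL s _)) => // s1 [L2 L] f1.
  split; [by rewrite f1 | | by rewrite f1 | by rewrite f1 | by rewrite !f1].
  rewrite L2 L take0 drop0; do 2!split=> //.
  by rewrite L2E LE catrevE -map_rev revK -map_cat cat_take_drop.
- apply: all_runs_any => x; apply: all_runs_any => y.
  apply: all_runs_seq; apply: all_runs_pop => l lE; apply: all_runs_push.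
  have [l1 l1E lE1] : exists2 l1, drop c (marking k a b) = (x, y) :: l1 & l = marks l1.
    by apply: marks_cons; rewrite -LE.
  have [lt_ck xyE lE2] := drop_marking l1E.
  split; rewrite /upd //=; split=> //; split; last by rewrite lE1 lE2.
  by rewrite take_marking // rev_rcons L2E -xyE.
Qed.

Definition bit_stacks B (s : memory) : Prop :=
  [/\ bit_stack B (s rP), bit_stack B (s rS), bit_stack B (s rD),
    bit_stack B (s rU) & bit_stack B (s rV)].

Lemma some_run_COMMAND k a b B st u v s : pass_inv k a b st s -> bit_stacks B s ->
  (u != v) || (st.1.2 < k) ->
  some_run (200 * B + 800 + 8 * k) (COMMAND (a == b.+1) u v) s (bit_stacks B.+4).
Proof.
case: st => [[w c] i] [T0 [ck [L2E LE]] PE SE [DE UE VE]] [nP nS nD nU nV].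
case: u; case: v => /= lt_ck.
- have := LE; rewrite drop_marking_cons // => lE.
  have := peekE lE; set x := _ == a; set y := _ == b.
  set s1 := upd _ _ _ => E1.
  have nS1 : bit_stack B (s1 rS) by rewrite E1.
  have nD1 : bit_stack B (s1 rD) by rewrite E1.
  have T1 : s1 rT = [::] by rewrite E1.
  eapply some_run_le.
    apply: (@some_run_any _ _ _ x); apply: (@some_run_any _ _ _ y).
    apply: some_run_seq; apply: (some_run_pop lE); apply: some_run_seq; apply: some_run_push.
    rewrite -/s1; apply: some_run_seq;
      apply: (some_run_mono (@some_run_ADD_IF y rS rD B s1 _ _ _ _)) => //.
    move=> s2 [S2 D2 T2 f2]; apply: some_run_seq.
    have nP2 : bit_stack B.+1 (s2 rP) by rewrite f2 // E1; apply: bit_stack_le nP _.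
    have nU2 : bit_stack B.+1 (s2 rU) by rewrite f2 // E1; apply: bit_stack_le nU _.
    apply: (some_run_mono (@some_run_ADD_IF x rP rU B.+1 s2 _ _ _ _)) => //.
    move=> s3 [P3 U3 T3 f3]; apply: some_run_frame.
    have nD3 : bit_stack B.+2 (s3 rD) by rewrite f3 //; apply: bit_stack_le D2 _.
    have nV3 : bit_stack B.+2 (s3 rV) by rewrite f3 // f2 // E1;
      exact: bit_stack_le nV (leqW (leqnSn B)).
    apply: (some_run_mono (@some_run_RESET (a == b.+1) s3 B.+2 B.+2 _ _ _ _ _)) => //.
    move=> s4 [D4 P4 U4 V4] f4.
    have S4 : bit_stack B.+1 (s4 rS) by rewrite f4 // f3.
    have le3 : B.+3 <= B.+4 by [].
    split; [exact: bit_stack_le P4 le3 | | exact: bit_stack_le D4 le3 | exact: bit_stack_le U4 le3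
           | exact: bit_stack_le V4 le3].
    by apply: bit_stack_le S4 _; rewrite ltnS 2?ltnW.
  clear; lia.
- eapply some_run_le.
    apply: some_run_seq; apply: some_run_push; apply: some_run_seq; apply: some_run_frame.
    set s1 := upd _ _ _; have nV1 : bit_stack B.+1 (s1 rV) by exact: bit_stack_le nV (leqnSn B).
    apply: (some_run_mono (@some_run_ADD rD rV B.+1 s1 _ _ _ _)) => // s2 [D2 V2] f2.
    do 2!(apply: some_run_seq; apply: some_run_push); apply: some_run_push.
    have le1 : B <= B.+4 by rewrite 4?leqW.
    have le2 : B.+2 <= B.+4 by rewrite 2?leqW.
    split; rewrite /upd /=.
    + by rewrite f2 //; exact: bit_stack_le nP le1.
    + by rewrite f2 //; exact: bit_stack_le nS le1.
    + exact: bit_stack_le D2 le2.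
    + by rewrite f2 //; apply: bit_stack_cons; apply: bit_stack_le nU _; rewrite 3?leqW.
    + by do 2!apply: bit_stack_cons.
  clear; lia.
- eapply some_run_le.
    apply: some_run_frame; apply: (some_run_mono (@some_run_MOVE rL2 rL s _ _ L2E)) => // s1 _ f1.
    by split; rewrite f1 //; [move: nP | move: nS | move: nD | move: nU | move: nV];
       move/bit_stack_le; apply; rewrite 4?leqW.
  rewrite size_rev size_takel ?size_map ?size_iota //; move: ck; clear; lia.
eapply some_run_le.
  have := LE; rewrite drop_marking_cons // => lE.
  apply: (@some_run_any _ _ _ (c.+1 == a)); apply: (@some_run_any _ _ _ (c == b)).
  apply: some_run_seq; apply: (some_run_pop lE); apply: some_run_push.
  by split; rewrite /upd /=; [move: nP | move: nS | move: nD | move: nU | move: nV];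
     move/bit_stack_le; apply; rewrite 4?leqW.
clear; lia.
Qed.

(** Replays the certificate to compute one coordinate in [rS], and rewinds. [p0] is the
    initial number of letters of the row, which is 1 for the virtual letter of row 0. *)
Definition PASS (m p0 : bool) : program :=
  CLEAR rP ;; CLEAR rS ;; Push rP (bit p0) ;; RESET m ;;
  Star (any (fun u => any (fun v =>
    Pop rZ (mark (u, v)) ;; Push rZ2 (mark (u, v)) ;; COMMAND m u v))) ;;
  @Empty 11 sym rZ ;; MOVE rZ2 rZ ;; MOVE rL2 rL.

Definition pass_ready (z : seq (bool * bool)) (s : memory) : Prop :=
  [/\ s rZ = marks z, s rZ2 = [::] & s rT = [::]].

Lemma catrev_marks l l' : catrev (marks l) (marks l') = marks (rev l ++ l').
Proof. by rewrite catrevE /marks map_cat map_rev. Qed.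

Lemma pass_inv_start k a b s : s rT = [::] -> s rL2 = [::] -> s rL = marks (marking k a b) ->
  stack_value (s rP) = (a == 0) -> stack_value (s rS) = 0 ->
    stack_value (s rD) = stack_value (s rP) ->
  stack_value (s rU) = 1 -> stack_value (s rV) = (a == b.+1) -> pass_inv k a b start_istate s.
Proof.
move=> T0 L20 LE PE SE DE UE VE; split=> //.
- by rewrite take0 drop0.
- by rewrite PE /row_letters addn0.
by rewrite DE PE UE VE /row_letters !muln1 muln0 !addn0.
Qed.

Lemma pass_inv_marks k a b st s s' : pass_inv k a b st s ->
  (forall l, l != rZ -> l != rZ2 -> s' l = s l) -> pass_inv k a b st s'.
Proof. by case: st => [[w c] i] H E; rewrite /pass_inv !E. Qed.

Lemma all_runs_PASS k a b z s : pass_ready z s -> s rL = marks (marking k a b) -> s rL2 = [::] ->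
  all_runs (PASS (a == b.+1) (a == 0)) s (fun s' =>
    [/\ stack_value (s' rS) = pairs a b (foldl (istep k) start_istate z).1.1,
        pass_ready z s', s' rL = s rL & s' rL2 = [::]]).
Proof.
move=> [ZE Z20 T0] LE L20.
apply: all_runs_seq; apply: all_runs_frame;
  apply: (all_runs_mono (@all_runs_CLEAR _ _)) => s1 P1 f1.
apply: all_runs_seq; apply: all_runs_frame;
  apply: (all_runs_mono (@all_runs_CLEAR _ _)) => s2 S2 f2.
apply: all_runs_seq; apply: all_runs_push; apply: all_runs_seq; apply: all_runs_frame.
set s3 := upd _ _ _; have T3 : s3 rT = [::] by rewrite /s3 /upd /= f2 // f1.
apply: (all_runs_mono (@all_runs_RESET _ _ T3)) => s4 [D4 P4 U4 V4 T4] f4.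
have P3 : stack_value (s3 rP) = (a == 0) by rewrite /s3 /upd /= f2 // P1 stack_value_cons addn0.
have E4 : [/\ s4 rZ = s rZ, s4 rZ2 = s rZ2, s4 rL = s rL, s4 rL2 = s rL2 & s4 rS = [::]].
  by split; rewrite f4 // /s3 /upd /= ?S2 // f2 // f1.
have [Z4 Z24 L4 L24 S4] := E4.
pose I1 (s' : memory) := exists z1 z2, [/\ z = z1 ++ z2, s' rZ = marks z2,
  s' rZ2 = marks (rev z1) & pass_inv k a b (foldl (istep k) start_istate z1) s'].
apply: all_runs_seq; apply: (@all_runs_star _ _ I1).
- exists [::], z; rewrite Z4 Z24; split=> //.
  by apply: pass_inv_start; rewrite ?L24 ?L4 ?D4 ?P4 ?P3 ?S4.
- move=> s' [z1 [z2 [zE Z2E Z1E HI]]]; apply: all_runs_any => u; apply: all_runs_any => v.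
  apply: all_runs_seq; apply: all_runs_pop => l; rewrite Z2E => /marks_cons[z3 z3E ->].
  apply: all_runs_seq; apply: all_runs_push; set s5 := upd _ _ _; subst z2.
  have I5 : pass_inv k a b (foldl (istep k) start_istate z1) s5.
    apply: pass_inv_marks HI _ => l1 /negbTE nZ /negbTE nZ2.
    by rewrite /s5 /upd nZ nZ2.
  apply: all_runs_frame; apply: (all_runs_mono (@all_runs_COMMAND _ _ _ _ u v _ I5)) => s6 I6 f6.
  exists (rcons z1 (u, v)), z3; rewrite cat_rcons rev_rcons foldl_rcons; split=> //.
  + by rewrite f6; [rewrite /s5 /upd | case: (u); case: (v)].
  + by rewrite f6; [rewrite /s5 /upd /= Z1E | case: (u); case: (v)].
move=> s5 [z1 [z2 [zE ZE5 Z2E5 HI]]]; apply: all_runs_seq; apply: all_runs_empty => Z0.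
have z20 : z2 = [::] by case: z2 {zE} ZE5 => //=; rewrite Z0.
move: HI zE Z2E5; rewrite z20 cats0 => HI -> Z2E5 {z2 z20 ZE5}.
apply: all_runs_seq; apply: all_runs_frame.
apply: (all_runs_mono (@all_runs_MOVE rZ2 rZ _ _)) => // s6 [Z26 Z6] f6.
apply: all_runs_frame; apply: (all_runs_mono (@all_runs_MOVE rL2 rL _ _)) => // s7 [L27 L7] f7.
move: HI; case: (foldl _ _ _) => [[w c] i] [T5 [ck [L2E5 LE5]] _ SE5 _].
rewrite L7 L27 /pass_ready !f7 // Z6 Z26 !f6 // Z0 T5 L2E5 LE5 Z2E5 SE5.
rewrite (catrev_marks _ [::]) catrev_marks !revK cats0 cat_take_drop.
by split=> //; rewrite LE.
Qed.

(** The factor [4 * n + 8] bounds the heights of the numbers, as a command increases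
    them by at most 4. *)
Definition tPASS k n : nat :=
  n * (200 * (4 * n + 8) + 820 + 8 * k) + 20 * (4 * n + 8) + 8 * n + 8 * k + 400.

Lemma some_run_PASS k a b z s B : B = 4 * size z + 8 ->
  pass_ready z s -> s rL = marks (marking k a b) -> s rL2 = [::] -> bit_stacks B s ->
  valid k start_istate z ->
  some_run (tPASS k (size z)) (PASS (a == b.+1) (a == 0)) s (bit_stacks B).
Proof.
move=> BE [ZE Z20 T0] LE L20 [nP nS nD nU nV] vz.
pose I1 m (s' : memory) := exists z1 z2, [/\ z = z1 ++ z2 /\ size z2 = m,
  s' rZ = marks z2 /\ s' rZ2 = marks (rev z1),
  pass_inv k a b (foldl (istep k) start_istate z1) s',
  valid k (foldl (istep k) start_istate z1) z2 & bit_stacks (4 * size z1 + 4) s'].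
eapply some_run_le.
  apply: some_run_seq; apply: some_run_frame;
    apply: (some_run_mono (some_run_CLEAR nP)) => // s1 P1 f1.
  have nS1 : bit_stack B (s1 rS) by rewrite f1.
  apply: some_run_seq; apply: some_run_frame;
    apply: (some_run_mono (some_run_CLEAR nS1)) => // s2 S2 f2.
  apply: some_run_seq; apply: some_run_push.
  set s3 := upd _ _ _; have T3 : s3 rT = [::] by rewrite /s3 /upd /= f2 // f1.
  have nD3 : bit_stack B (s3 rD) by rewrite /s3 /upd /= f2 // f1.
  have nU3 : bit_stack B (s3 rU) by rewrite /s3 /upd /= f2 // f1.
  have nV3 : bit_stack B (s3 rV) by rewrite /s3 /upd /= f2 // f1.
  have nP3 : bit_stack 1 (s3 rP) by rewrite /s3 /upd /= f2 // P1.
  apply: some_run_seq; apply: some_run_frame.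
  have := some_and_all_runs (@some_run_RESET (a == b.+1) s3 1 B T3 nP3 nD3 nU3 nV3)
                  (@all_runs_RESET _ _ T3).
  move/some_run_mono; apply=> // s4 [[nD4 nP4 nU4 nV4] [D4 P4 U4 V4 T4]] f4.
  have P3 : stack_value (s3 rP) = (a == 0) by rewrite /s3 /upd /= f2 // P1 stack_value_cons addn0.
  have E4 : [/\ s4 rZ = s rZ, s4 rZ2 = s rZ2, s4 rL = s rL, s4 rL2 = s rL2 & s4 rS = [::]].
    by split; rewrite f4 // /s3 /upd /= ?S2 // f2 // f1.
  have [Z4 Z24 L4 L24 S4] := E4.
  apply: some_run_seq.
  apply: (some_run_mono (@some_run_loop _ _ I1 (200 * B + 810 + 8 * k) _ _ (size z) _ _)) => //.
  - exists [::], z; rewrite Z4 Z24; split=> //.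
      by apply: pass_inv_start; rewrite ?L24 ?L4 ?D4 ?P4 ?P3 ?S4.
    rewrite /bit_stacks S4; split=> //; [exact: bit_stack_le nP4 _ | exact: bit_stack_le nD4 _ |
      exact: bit_stack_le nU4 _ | exact: bit_stack_le nV4 _].
  - move=> m s' mB [z1 [[|[u v] z2] [[zE //= [sz]] [Z2E Z1E] HI /andP[uv v2] nn]]].
    have szB : 4 * size z1 + 4 <= B.
      rewrite BE zE size_cat; clear; lia.
    eapply some_run_le.
      apply: (@some_run_any _ _ _ u); apply: (@some_run_any _ _ _ v).
      apply: some_run_seq; apply: some_run_pop; first exact: Z2E.
      apply: some_run_seq; apply: some_run_push; set s5 := upd _ _ _.
      have I5 : pass_inv k a b (foldl (istep k) start_istate z1) s5.
        apply: pass_inv_marks HI _ => l1 /negbTE nZ /negbTE nZ2.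
        by rewrite /s5 /upd nZ nZ2.
      have n5 : bit_stacks (4 * size z1 + 4) s5 by [].
      apply: some_run_frame.
      apply: (some_run_mono (some_and_all_runs (some_run_COMMAND I5 n5 uv) (@all_runs_COMMAND _
        _ _ _ u v _ I5)) (leqnn _)).
      move=> s6 [n6 I6] f6.
      exists (rcons z1 (u, v)), z2; rewrite cat_rcons rev_rcons foldl_rcons size_rcons.
      split=> //.
      + rewrite !f6; [|by case: (u); case: (v)..].
        by rewrite /s5 /upd /= Z1E.
      + by rewrite (_ : 4 * (size z1).+1 + 4 = (4 * size z1 + 4).+4) //; clear; lia.
    by move: szB; clear; lia.
  - move=> s5 [z1 [z2 [[zE /size0nil z20] [ZE5 Z2E5] HI _ n5]]].
    rewrite {z2}z20 cats0 in zE ZE5; rewrite -zE in Z2E5 HI n5.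
    have nB5 : bit_stacks B s5.
      have le5 : 4 * size z + 4 <= B by rewrite BE leq_add2l.
      by case: n5 => *; split; apply: bit_stack_le le5.
    apply: some_run_seq; apply: some_run_empty => //; apply: some_run_seq; apply: some_run_frame.
    apply: (some_run_mono (@some_run_MOVE rZ2 rZ _ _ _ Z2E5)) => // s6 _ f6.
    move: HI; case: (foldl _ _ _) => [[w c] i] [T5 [ck [L2E5 LE5]] _ SE5 _].
    have L26 : s6 rL2 = marks (rev (take c (marking k a b))) by rewrite f6.
    apply: some_run_frame; apply: (some_run_mono (@some_run_MOVE rL2 rL _ _ isT L26)); last first.
      by move=> s7 _ f7; rewrite /bit_stacks !f7 // !f6.
    apply: (leq_trans (n := 8 * k + 8)); last exact: leqnn.
    by rewrite size_rev size_takel ?size_map ?size_iota // leq_add2r leq_mul2l ck.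
rewrite size_rev /tPASS -BE; clear -BE; nia.
Qed.

(** Consumes one coordinate of the input, which must be the canonical numeral of the value of
    [rS]: it is empty or its last digit is 1, and only zeros remain on [rS] after it. *)
Definition COMPARE : program :=
  Alt (Skip 11 sym)
    (Star (any (fun b => Pop rS (bit b) ;; Pop rI (bit b))) ;;
     Pop rS (bit true) ;; Pop rI (bit true)) ;;
  Pop rI stop ;; Star (Pop rS (bit false)) ;; @Empty 11 sym rS.

Definition input (x : seq (option bool)) : seq sym := map inl x.

Definition bits (u : seq bool) : seq sym := map bit u.

Lemma bits_rcons u b : bits (rcons u b) = bits u ++ [:: bit b].
Proof. by rewrite /bits map_rcons cats1. Qed.

Lemma input_cat x y : input (x ++ y) = input x ++ input y.
Proof. exact: map_cat. Qed.

Lemma input_number_code n : input (number_code n) = bits (binary n) ++ [:: stop].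
Proof. by rewrite /input /number_code map_rcons -cats1 -map_comp. Qed.

Lemma stack_value_bits u l : stack_value (bits u ++ l) = bval u + 2 ^ size u * stack_value l.
Proof. by elim: u => [|b u IH] /=; rewrite ?mul1n // stack_value_cons IH expnS; lia. Qed.

Lemma stack_value_nseq0 n : stack_value (nseq n (bit false)) = 0.
Proof. by elim: n => //= n IH; rewrite stack_value_cons IH. Qed.

Lemma all_runs_COMPARE s : all_runs COMPARE s (fun s' =>
  s' rS = [::] /\ s rI = input (number_code (stack_value (s rS))) ++ s' rI).
Proof.
pose I1 (s' : memory) := exists u, s rS = bits u ++ s' rS /\ s rI = bits u ++ s' rI.
have rest u (s1 : memory) : u = [::] \/ last false u -> s rS = bits u ++ s1 rS ->
    s rI = bits u ++ s1 rI ->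
    all_runs (Pop rI stop ;; Star (Pop rS (bit false)) ;; @Empty 11 sym rS) s1
      (fun s' => s' rS = [::] /\ s rI = input (number_code (stack_value (s rS))) ++ s' rI).
  move=> uP SE IE; apply: all_runs_seq; apply: all_runs_pop => l lE; apply: all_runs_seq.
  apply: (@all_runs_star _ _ (fun s2 => s2 rI = l /\
      exists n, s1 rS = nseq n (bit false) ++ s2 rS)).
  - by split; last by exists 0.
  - move=> s2 [I2 [n nE]]; apply: all_runs_pop => l2 l2E; split=> //.
    by exists n.+1; rewrite nE l2E /upd /=; elim: (n) => //= m ->.
  - move=> s2 [I2 [n nE]]; apply: all_runs_empty => S0; split=> //.
    rewrite IE lE I2 SE nE S0 cats0 stack_value_bits stack_value_nseq0 muln0 addn0.
    by rewrite input_number_code binary_bval // -catA.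
apply: all_runs_seq; apply: all_runs_alt; first by apply: all_runs_skip; apply: (rest [::]);
  [left | |].
apply: all_runs_seq; apply: (@all_runs_star _ _ I1); first by exists [::].
  move=> s1 [u [SE IE]]; apply: all_runs_any => b.
  apply: all_runs_seq; apply: all_runs_pop => l lE; apply: all_runs_pop => l' lE'.
  rewrite /upd /= in lE'.
  by exists (rcons u b); rewrite /upd /= SE IE lE lE' bits_rcons -!catA.
move=> s1 [u [SE IE]].
apply: all_runs_seq; apply: all_runs_pop => l lE; apply: all_runs_pop => l' lE'.
rewrite /upd /= in lE'; apply: (rest (rcons u true)); rewrite ?last_rcons; first by right.
  by rewrite SE lE bits_rcons -catA.
by rewrite IE lE' bits_rcons -catA.
Qed.

Lemma bit_stack_bits B l : bit_stack B l -> exists u, l = bits u /\ size u <= B.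
Proof.
case/andP=> lb lB; have [u uE] : exists u, l = bits u.
  elim: l lb {lB} => [|[[b|]|] l IH] //=; first by exists [::].
  by move=> /IH[u ->]; exists (b :: u).
by exists u; split=> //; rewrite uE size_map in lB.
Qed.

(** Splits a numeral into the part that [COMPARE] must match and the superfluous zeros
    that it must discard. *)
Lemma binary_pad u : exists j, u = binary (bval u) ++ nseq j false.
Proof.
elim: u => [|b u [j uE]]; first by exists 0.
have [v0|] := posnP (bval (b :: u)); last first.
  move=> v0; exists j; rewrite binary_rec // [in RHS]/= oddD odd_double addbF halfD.
  by rewrite odd_double andbF doubleK [in LHS]uE; case: b {v0} => /=.
move: v0 uE; case: b => //= v0; have -> : bval u = 0 by lia.
by move=> ->; exists j.+1.
Qed.

Lemma some_run_COMPARE B s l : bit_stack B (s rS) ->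
  s rI = input (number_code (stack_value (s rS))) ++ l ->
  some_run (20 * B + 40) COMPARE s (fun s' => s' rI = l).
Proof.
move=> nS IE.
suff [s' [n [nt e _]]] : some_run (20 * B + 40) COMPARE s (fun _ => True).
  exists s', n; split=> //; have [_] := all_runs_COMPARE e.
  by rewrite IE => /(congr1 (drop (size (input (number_code (stack_value (s rS)))))));
    rewrite !drop_size_cat.
have [u [SE uB]] := bit_stack_bits nS; have [j uE] := binary_pad u.
rewrite SE -[bits u]cats0 stack_value_bits muln0 addn0 input_number_code -catA in IE.
set w := binary (bval u) in uE IE.
have rest (s1 : memory) : s1 rI = stop :: l -> s1 rS = bits (nseq j false) ->
    some_run (3 * j + 10) (Pop rI stop ;; Star (Pop rS (bit false)) ;; @Empty 11 sym rS) s1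
     (fun _ => True).
  move=> I1 S1; eapply some_run_le.
    apply: some_run_seq; apply: (some_run_pop I1); apply: some_run_seq.
    apply: (some_run_mono (@some_run_loop _ _ (fun m s2 =>
      s2 rS = bits (nseq m false)) 1 _ _ j _ _)) => //.
      by move=> m s2 _ S2; apply: some_run_pop; first exact: S2.
    by move=> s2 S2; apply: some_run_empty.
  by clear; lia.
have uj : size u = size w + j by rewrite uE size_cat size_nseq.
have [v0|v0] := posnP (bval u).
  have w0 : w = [::] by rewrite /w v0.
  rewrite w0 in IE uE uj; eapply some_run_le.
    apply: some_run_seq; apply: some_run_altl; apply: some_run_skip; apply: rest => //.
    by rewrite SE uE.
  by rewrite add0n in uj; clear -uj uB; lia.
have := last_binary v0; rewrite -/w; case/lastP: w IE uE uj => // w b IE uE uj.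
rewrite last_rcons => bT; rewrite {}bT bits_rcons -!catA /= in IE uE.
eapply some_run_le.
  apply: some_run_seq; apply: some_run_altr; apply: some_run_seq.
  pose I1 m (s1 : memory) := exists w1, [/\ size w1 = m,
     s1 rI = bits w1 ++ [:: bit true, stop & l] &
     s1 rS = bits w1 ++ bit true :: bits (nseq j false)].
  apply: (some_run_mono (@some_run_loop _ _ I1 4 _ _ (size w) _ _)) => //.
  - exists w; split=> //; rewrite SE uE cat_rcons /bits map_cat //.
  - move=> m s1 _ [[|b1 w1] [//= [sz] I1E S1E]]; eapply some_run_le.
      apply: (@some_run_any _ _ _ b1); apply: some_run_seq; apply: (some_run_pop S1E).
      by apply: some_run_pop; [exact: I1E | exists w1].
    by [].
  - move=> s1 [w1 [/size0nil -> /= I1E S1E]].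
    apply: some_run_seq; apply: (some_run_pop S1E); apply: some_run_pop; first exact: I1E.
    by apply: rest.
by rewrite size_rcons in uj; clear -uj uB; lia.
Qed.

(** * Looping over the coordinates *)

(** Advances to the first mark that is not skipped, which must be [t], and replaces it
    by [r]. When [t] itself may not be skipped, the guess of where to stop is forced. *)
Definition FIND (skip : pred (bool * bool)) (t r : bool * bool) : program :=
  Star (any (fun x => any (fun y =>
    if skip (x, y) then Pop rL (mark (x, y)) ;; Push rL2 (mark (x, y))
    else Skip 11 sym))) ;;
  Pop rL (mark t) ;; Push rL2 (mark r).

Lemma all_runs_FIND skip t r s l1 l2 l : s rL = marks (l1 ++ t :: l2) -> s rL2 = marks l ->
  all skip l1 -> ~~ skip t ->
  all_runs (FIND skip t r) s (fun s' => s' rL = marks l2 /\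
    s' rL2 = marks (r :: rev l1 ++ l)).
Proof.
move=> LE L2E sl st.
pose I1 (s1 : memory) := exists l3 l4, [/\ l1 = l3 ++ l4, s1 rL = marks (l4 ++ t :: l2) &
  s1 rL2 = marks (rev l3 ++ l)].
apply: all_runs_seq; apply: (@all_runs_star _ _ I1); first by exists [::], l1.
  move=> s1 [l3 [l4 [l1E L1 L21]]]; apply: all_runs_any => x; apply: all_runs_any => y.
  case: ifP => sk; last by apply: all_runs_skip; exists l3, l4.
  apply: all_runs_seq; apply: all_runs_pop => l5; rewrite L1; case: l4 l1E L1 => [|m l4] l1E L1.
    by move=> [tE _]; rewrite tE sk in st.
  move=> -[mE <-]; apply: all_runs_push; exists (rcons l3 (x, y)), l4.
  by rewrite cat_rcons rev_rcons /upd /= L21 -mE; split.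
move=> s1 [l3 [l4 [l1E L1 L21]]].
apply: all_runs_seq; apply: all_runs_pop => l5; rewrite L1; case: l4 l1E L1 => [|m l4] l1E L1.
  by move=> -[<-]; apply: all_runs_push; rewrite /upd /= L21 l1E cats0.
by move=> -[mE _]; move: sl; rewrite l1E all_cat /= mE (negbTE st) andbF.
Qed.

Lemma some_run_FIND skip t r s l1 l2 : s rL = marks (l1 ++ t :: l2) -> all skip l1 ->
  some_run (10 * size l1 + 10) (FIND skip t r) s (fun s' => True).
Proof.
move=> LE sl.
pose I1 m (s1 : memory) := exists l3, [/\ size l3 = m, all skip l3 &
   s1 rL = marks (l3 ++ t :: l2)].
eapply some_run_le.
  apply: some_run_seq; apply: (some_run_mono (@some_run_loop _ _ I1 6 _ _ (size l1) _ _)) => //.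
  - by exists l1.
  - move=> m s1 _ [[|[x y] l3] [//= [sz] /andP[sk sl3] L1]]; eapply some_run_le.
      apply: (@some_run_any _ _ _ x); apply: (@some_run_any _ _ _ y); rewrite sk.
      by apply: some_run_seq; apply: (some_run_pop L1); apply: some_run_push; exists l3.
    by [].
  - move=> s1 [l3 [/size0nil -> _ L1]].
    by apply: some_run_seq; apply: (some_run_pop L1); apply: some_run_push.
by clear; lia.
Qed.

(** Checks the coordinates of one row. Each turn marks a column, rewinds, checks the
    coordinate, and returns to the marked column to erase the mark and go on. *)
Definition ROW (p0 : bool) : program :=
  Star (any (fun x =>
    Pop rL (mark (x, false)) ;; Push rL (mark (x, true)) ;; MOVE rL2 rL ;;
    PASS x p0 ;; COMPARE ;; FIND (fun m => ~~ m.2) (x, true) (x, false))) ;;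
  @Empty 11 sym rL ;; MOVE rL2 rL.

Lemma size_marking k a b : size (marking k a b) = k.
Proof. by rewrite size_map size_iota. Qed.

Lemma nth_marking k a b j : j < k -> nth (false, false) (marking k a b) j = (j.+1 == a, j == b).
Proof. by move=> jk; rewrite (nth_map 0) ?size_iota // nth_iota. Qed.

(** As there is no column [k], [marking k a k] is the marking of row [a] in which no
    column is marked. *)
Lemma marking_col k a j : j < k ->
  marking k a j = take j (marking k a k) ++ (j.+1 == a, true) :: drop j.+1 (marking k a k).
Proof.
move=> jk; have sz : size (take j (marking k a k)) = j by rewrite size_takel // size_marking ltnW.
apply: (@eq_from_nth _ (false, false)).
  by rewrite size_cat /= size_drop sz !size_marking; lia.
rewrite size_marking => i ik; rewrite nth_marking // nth_cat sz.
case: (ltngtP i j) => [ij|ij|->]; last by rewrite subnn.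
  by rewrite nth_take // nth_marking // [i == k]ltn_eqF // (ltn_eqF ij).
rewrite (_ : i - j = (i - j.+1).+1) /=; last by lia.
by rewrite nth_drop subnKC // nth_marking // [i == k]ltn_eqF // gtn_eqF.
Qed.

Lemma marking_row k j : j < k ->
  marking k j.+1 k = take j (marking k 0 k) ++ (true, false) :: drop j.+1 (marking k 0 k).
Proof.
move=> jk; have sz : size (take j (marking k 0 k)) = j by rewrite size_takel // size_marking ltnW.
apply: (@eq_from_nth _ (false, false)).
  by rewrite size_cat /= size_drop sz !size_marking; lia.
rewrite size_marking => i ik; rewrite nth_marking // nth_cat sz.
rewrite [i == k]ltn_eqF // eqSS.
case: (ltngtP i j) => [ij|ij|->]; last by rewrite subnn.
  by rewrite nth_take // nth_marking // [i == k]ltn_eqF // (ltn_eqF ij).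
rewrite (_ : i - j = (i - j.+1).+1) /=; last by lia.
by rewrite nth_drop subnKC // nth_marking // [i == k]ltn_eqF // gtn_eqF.
Qed.

Lemma all_marking_col k a j : all (fun m => ~~ m.2) (take j (marking k a k)).
Proof.
apply/allP => m /mem_take /mapP[i]; rewrite mem_iota => /andP[_ ik] -> /=.
by rewrite ltn_eqF.
Qed.

Lemma all_marking_row k j : all (fun m => ~~ m.1) (take j (marking k 0 k)).
Proof. by apply/allP => m /mem_take /mapP[i _ ->]. Qed.

Section Correctness.
Variables (k : nat) (z : seq (bool * bool)).
Let w := (foldl (istep k) start_istate z).1.1.
Let B := 4 * size z + 8.

Definition cols a n m := flatten [seq number_code (pairs a b w) | b <- iota n m].

Lemma cols_rcons a n : cols a 0 n.+1 = cols a 0 n ++ number_code (pairs a n w).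
Proof. by rewrite /cols -[n.+1]addn1 iotaD map_cat flatten_cat /= cats0. Qed.

Lemma all_runs_ROW a s : pass_ready z s -> s rL = marks (marking k a k) -> s rL2 = [::] ->
  all_runs (ROW (a == 0)) s (fun s' => [/\ pass_ready z s', s' rL = marks (marking k a k),
    s' rL2 = [::] & s rI = input (enc_row k w a) ++ s' rI]).
Proof.
move=> env0 L0 L20; set p := marking k a k in L0 *.
pose I1 (s1 : memory) := exists j, [/\ j <= k, pass_ready z s1, s1 rL2 = marks (rev (take j p)),
  s1 rL = marks (drop j p) & s rI = input (cols a 0 j) ++ s1 rI].
apply: all_runs_seq; apply: (@all_runs_star _ _ I1).
- by exists 0; rewrite take0 drop0.
- move=> s1 [j [jk env1 L2 L1 I1E]]; apply: all_runs_any => x.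
  apply: all_runs_seq; apply: all_runs_pop => l lE; apply: all_runs_seq; apply: all_runs_push.
  have [l1 l1E lE1] : exists2 l1, drop j p = (x, false) :: l1 & l = marks l1.
    by apply: marks_cons; rewrite -L1.
  have [lt_jk [xE _] lE2] := drop_marking l1E.
  apply: all_runs_seq; apply: all_runs_frame;
    apply: (all_runs_mono (@all_runs_MOVE rL2 rL _ _)) => //.
  move=> s2 [L22 L21] f2.
  have {}L21 : s2 rL = marks (marking k a j).
    rewrite L21 /upd /= L2 lE1 lE2 (catrev_marks _ (_ :: _)) revK.
    by rewrite (marking_col a lt_jk) xE.
  have env2 : pass_ready z s2 by case: env1 => *; split; rewrite f2.
  rewrite xE eq_sym; apply: all_runs_seq; apply: all_runs_frame.
  apply: (all_runs_mono (all_runs_PASS env2 L21 L22)) => s3 [S3 env3 L31 L32] f3.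
  apply: all_runs_seq; apply: all_runs_frame;
    apply: (all_runs_mono (@all_runs_COMPARE _)) => s4 [S4 I4] f4.
  have L41 : s4 rL = marks (take j p ++ (a == j.+1, true) :: drop j.+1 p).
    by rewrite f4 // L31 L21 (marking_col a lt_jk) eq_sym.
  have L42 : s4 rL2 = marks [::] by rewrite f4.
  apply: all_runs_frame; apply: (all_runs_mono (all_runs_FIND (skip := fun m =>
    ~~ m.2) L41 L42 _ _)) => //.
    exact: all_marking_col.
  move=> s5 [L5 L52] f5; exists j.+1; split=> //.
  + by case: env3 => *; split; rewrite f5 // f4.
  + by rewrite L52 cats0 take_marking // rev_rcons [j == k]ltn_eqF // eq_sym.
  + rewrite I1E cols_rcons input_cat -catA f5 // -S3 -I4 f3 // f2 //.
- move=> s1 [j [jk env1 L2 L1 I1E]]; apply: all_runs_seq; apply: all_runs_empty => Lnil.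
  have jE : j = k.
    move: Lnil; rewrite L1 => /(congr1 size); rewrite size_map size_drop size_marking /=; lia.
  apply: all_runs_frame; apply: (all_runs_mono (@all_runs_MOVE rL2 rL _ _)) => // s2 [L22 L21] f2.
  split=> //; last by rewrite f2 // I1E jE.
    by case: env1 => *; split; rewrite f2.
  by rewrite L21 L2 L1 catrev_marks revK cat_take_drop.
Qed.

Definition tROW n : nat := k * (tPASS k n + 20 * (4 * n + 8) + 20 * k + 100) + 8 * k + 20.

Lemma some_run_ROW a s l : pass_ready z s -> s rL = marks (marking k a k) -> s rL2 = [::] ->
  bit_stacks B s -> valid k start_istate z -> s rI = input (enc_row k w a) ++ l ->
  some_run (tROW (size z)) (ROW (a == 0)) s (fun s' => bit_stacks B s' /\ s' rI = l).
Proof.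
move=> env0 L0 L20 nn vz IE; set p := marking k a k in L0 *.
suff [s' [n [nt e n']]] : some_run (tROW (size z)) (ROW (a == 0)) s (bit_stacks B).
  exists s', n; split=> //; split=> //; have [_ _ _] := all_runs_ROW env0 L0 L20 e.
  by rewrite IE => /(congr1 (drop (size (input (enc_row k w a))))); rewrite !drop_size_cat.
pose I1 m (s1 : memory) := exists j, [/\ j + m = k, pass_ready z s1,
  s1 rL2 = marks (rev (take j p)) /\ s1 rL = marks (drop j p),
  bit_stacks B s1 & s1 rI = input (cols a j m) ++ l].
eapply some_run_le.
  apply: some_run_seq.
  apply: (some_run_mono (@some_run_loop _ _ I1 (tPASS k (size z) + 20 * B + 20 * k + 90) _ _ k _
    _)) => //.
  - by exists 0; rewrite take0 drop0.
  - move=> m s1 _ [j [jk env1 [L2 L1] n1 I1E]].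
    have lt_jk : j < k by rewrite -jk -addSnnS leq_addr.
    have := L1; rewrite drop_marking_cons // => lE.
    eapply some_run_le.
      apply: (@some_run_any _ _ _ (j.+1 == a)); rewrite [j == k]ltn_eqF // in lE.
      apply: some_run_seq; apply: (some_run_pop lE); apply: some_run_seq; apply: some_run_push.
      apply: some_run_seq; set s2 := upd _ _ _; apply: some_run_frame.
      have L2' : s2 rL2 = marks (rev (take j p)) by rewrite -L2.
      apply: (some_run_mono (some_and_all_runs (@some_run_MOVE rL2 rL s2 _ isT L2')
        (@all_runs_MOVE rL2 rL s2 isT))) => //.
      move=> s3 [_ [L32 L31]] f3.
      have {}L31 : s3 rL = marks (marking k a j).
        rewrite L31 /s2 /upd /= L2 (catrev_marks _ (_ :: _)) revK.
        by rewrite (marking_col a lt_jk).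
      have env3 : pass_ready z s3 by case: env1 => *; split; rewrite f3.
      have n3 : bit_stacks B s3 by case: n1 => *; split; rewrite f3.
      have P3 := some_run_PASS (erefl B) env3 L31 L32 n3 vz.
      rewrite [_.+1 == a]eq_sym; apply: some_run_seq; apply: some_run_frame.
      apply: (some_run_mono (some_and_all_runs P3 (all_runs_PASS env3 L31 L32))) => //.
      move=> s4 [n4 [S4 env4 L41 L42]] f4.
      have I4 : s4 rI = input (number_code (stack_value (s4 rS))) ++ input (cols a j.+1 m) ++ l.
        by rewrite f4 // f3 // S4 /s2 /upd /= I1E catA -input_cat.
      have nS4 : bit_stack B (s4 rS) by case: n4.
      apply: some_run_seq; apply: some_run_frame.
      apply: (some_run_mono (some_and_all_runs (some_run_COMPARE nS4 I4) (@all_runs_COMPARE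
        s4))) => //.
      move=> s5 [I5 [S5 _]] f5.
      have L51 : s5 rL = marks (take j p ++ (a == j.+1, true) :: drop j.+1 p).
        by rewrite f5 // L41 L31 (marking_col a lt_jk) eq_sym.
      have L52 : s5 rL2 = marks [::] by rewrite f5.
      have al := all_marking_col k a j.
      apply: some_run_frame.
      apply: (some_run_mono (some_and_all_runs (some_run_FIND (skip := fun m =>
        ~~ m.2) (t := (a == j.+1, true)) (a == j.+1, false) L51 al)
         (all_runs_FIND (skip := fun m => ~~ m.2) (r := (a == j.+1,
           false)) L51 L52 al isT))) => //.
      move=> s6 [_ [L6 L62]] f6; exists j.+1; split; first by rewrite addSnnS.
      + by case: env4 => *; split; rewrite f6 // f5.
      + by rewrite L6 L62 cats0 take_marking // rev_rcons [j == k]ltn_eqF // eq_sym.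
      + by case: n4 => *; split; rewrite f6 ?S5 ?f5.
      + by rewrite f6.
    rewrite size_rev size_takel ?size_marking 1?ltnW //.
    by move: lt_jk; clear; set T := tPASS _ _; lia.
  - move=> s1 [j [jk env1 [L2 L1] n1 I1E]].
    rewrite addn0 in jk; apply: some_run_seq; apply: some_run_empty.
      by rewrite L1 jk drop_oversize // size_marking.
    apply: some_run_frame; apply: (some_run_mono (@some_run_MOVE rL2 rL s1 _ isT L2)); last first.
      by move=> s2 _ f2; case: n1 => *; split; rewrite f2.
    rewrite size_rev jk take_oversize size_marking //; exact: leqnn.
by rewrite /tROW -/B; clear; set T := tPASS _ _; nia.
Qed.

(** Row 0, for which no letter is marked, and then a loop like that of [ROW] on the marks
    of the row. *)
Definition ROWS : program :=
  ROW true ;;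
  Star (Pop rL (mark (false, false)) ;; Push rL (mark (true, false)) ;; MOVE rL2 rL ;;
    ROW false ;; FIND (fun m => ~~ m.1) (true, false) (false, false)) ;;
  @Empty 11 sym rL.

Definition rows n m := flatten [seq enc_row k w a | a <- iota n m].

Lemma rows_rcons n : rows 0 n.+1 = rows 0 n ++ enc_row k w n.
Proof. by rewrite /rows -[n.+1]addn1 iotaD map_cat flatten_cat /= cats0. Qed.

Lemma marking_none : marking k 0 k = nseq k (false, false).
Proof.
apply: (@eq_from_nth _ (false, false)); rewrite size_marking ?size_nseq // => i ik.
by rewrite nth_marking // nth_nseq ik [i == k]ltn_eqF.
Qed.

Lemma drop_marking_none j : j < k ->
  drop j (marking k 0 k) = (false, false) :: drop j.+1 (marking k 0 k).
Proof. by move=> jk; rewrite drop_marking_cons // [j == k]ltn_eqF. Qed.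

Lemma all_runs_ROWS s : pass_ready z s -> s rL = marks (marking k 0 k) -> s rL2 = [::] ->
  all_runs ROWS s (fun s' => s rI = input (rows 0 k.+1) ++ s' rI).
Proof.
move=> env0 L0 L20; set p := marking k 0 k in L0 *.
pose I1 (s1 : memory) := exists j, [/\ j <= k, pass_ready z s1, s1 rL2 = marks (rev (take j p)),
  s1 rL = marks (drop j p) & s rI = input (rows 0 j.+1) ++ s1 rI].
apply: all_runs_seq; apply: (all_runs_mono (all_runs_ROW env0 L0 L20)) => s0 [env1 L1 L2 I1E].
apply: all_runs_seq; apply: (@all_runs_star _ _ I1).
- by exists 0; rewrite take0 drop0 rows_rcons.
- move=> {s0 env1 L1 L2 I1E} s1 [j [jk env1 L2 L1 I1E]].
  apply: all_runs_seq; apply: all_runs_pop => l lE; apply: all_runs_seq; apply: all_runs_push.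
  have [l1 l1E lE1] : exists2 l1, drop j p = (false, false) :: l1 & l = marks l1.
    by apply: marks_cons; rewrite -L1.
  have [lt_jk _ lE2] := drop_marking l1E.
  apply: all_runs_seq; apply: all_runs_frame;
    apply: (all_runs_mono (@all_runs_MOVE rL2 rL _ _)) => //.
  move=> s2 [L22 L21] f2.
  have {}L21 : s2 rL = marks (marking k j.+1 k).
    by rewrite L21 /upd /= L2 lE1 lE2 (catrev_marks _ (_ :: _)) revK (marking_row lt_jk).
  have env2 : pass_ready z s2 by case: env1 => *; split; rewrite f2.
  apply: all_runs_seq; apply: (all_runs_mono (all_runs_ROW env2 L21 L22)) => s4 [env4 L41 L42 I4].
  have {}L41 : s4 rL = marks (take j p ++ (true, false) :: drop j.+1 p).
    by rewrite L41 (marking_row lt_jk).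
  apply: all_runs_frame; apply: (all_runs_mono (all_runs_FIND (skip := fun m =>
    ~~ m.1) L41 (L42 : _ = marks [::]) _ _)) => //.
    exact: all_marking_row.
  move=> s5 [L5 L52] f5; exists j.+1; split=> //.
  + by case: env4 => *; split; rewrite f5.
  + by rewrite L52 cats0 take_marking // rev_rcons [j == k]ltn_eqF.
  + by rewrite I1E (rows_rcons j.+1) input_cat -catA f5 // -I4 f2.
- move=> {s0 env1 L1 L2 I1E} s1 [j [jk env1 L2 L1 I1E]]; apply: all_runs_empty => Lnil.
  have jE : j = k.
    move: Lnil; rewrite L1 => /(congr1 size); rewrite size_map size_drop size_marking /=; lia.
  by rewrite I1E jE.
Qed.

Definition tROWS n : nat := k.+1 * (tROW n + 20 * k + 50) + 20.

Lemma some_run_ROWS s l : pass_ready z s -> s rL = marks (marking k 0 k) -> s rL2 = [::] ->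
  bit_stacks B s -> valid k start_istate z -> s rI = input (rows 0 k.+1) ++ l ->
  some_run (tROWS (size z)) ROWS s (fun s' => s' rI = l).
Proof.
move=> env0 L0 L20 nn vz IE; set p := marking k 0 k in L0 *.
pose I1 m (s1 : memory) := exists j, [/\ j + m = k, pass_ready z s1,
  s1 rL2 = marks (rev (take j p)) /\ s1 rL = marks (drop j p),
  bit_stacks B s1 & s1 rI = input (rows j.+1 m) ++ l].
eapply some_run_le.
  have {}IE : s rI = input (enc_row k w 0) ++ input (rows 1 k) ++ l.
    by rewrite IE /rows /= input_cat -catA.
  apply: some_run_seq.
  apply: (some_run_mono (some_and_all_runs (some_run_ROW env0 L0 L20 nn vz IE) (all_runs_ROW
    env0 L0 L20))) => //.
  move=> s0 [[n0 I0] [env1 L1 L2 _]]; apply: some_run_seq.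
  apply: (some_run_mono (@some_run_loop _ _ I1 (tROW (size z) + 20 * k + 40) _ _ k _ _)) => //.
  - by exists 0; rewrite take0 drop0.
  - move=> {s0 n0 I0 env1 L1 L2} m s1 _ [j [jk env1 [L2 L1] n1 I1E]].
    have lt_jk : j < k by rewrite -jk -addSnnS leq_addr.
    have := L1; rewrite drop_marking_none // => lE.
    eapply some_run_le.
      apply: some_run_seq; apply: (some_run_pop lE); apply: some_run_seq; apply: some_run_push.
      apply: some_run_seq; set s2 := upd _ _ _; apply: some_run_frame.
      have L2' : s2 rL2 = marks (rev (take j p)) by rewrite -L2.
      apply: (some_run_mono (some_and_all_runs (@some_run_MOVE rL2 rL s2 _ isT L2')
        (@all_runs_MOVE rL2 rL s2 isT))) => //.
      move=> s3 [_ [L32 L31]] f3.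
      have {}L31 : s3 rL = marks (marking k j.+1 k).
        rewrite L31 /s2 /upd /= L2 (catrev_marks _ (_ :: _)) revK.
        by rewrite (marking_row lt_jk).
      have env3 : pass_ready z s3 by case: env1 => *; split; rewrite f3.
      have n3 : bit_stacks B s3 by case: n1 => *; split; rewrite f3.
      have I3 : s3 rI = input (enc_row k w j.+1) ++ input (rows j.+2 m) ++ l.
        by rewrite f3 // /s2 /upd /= I1E /rows /= input_cat -catA.
      apply: some_run_seq.
      apply: (some_run_mono (some_and_all_runs (some_run_ROW env3 L31 L32 n3 vz I3)
        (all_runs_ROW env3 L31 L32))) => //.
      move=> s5 [[n5 I5] [env5 L51 L52 _]].
      have {}L51 : s5 rL = marks (take j p ++ (true, false) :: drop j.+1 p).
        by rewrite L51 (marking_row lt_jk).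
      have {}L52 : s5 rL2 = marks [::] by rewrite L52.
      have al := all_marking_row k j.
      apply: some_run_frame.
      apply: (some_run_mono (some_and_all_runs (some_run_FIND (skip := fun m =>
        ~~ m.1) (false, false) L51 al)
         (all_runs_FIND (skip := fun m => ~~ m.1) (r := (false, false)) L51 L52 al isT))) => //.
      move=> s6 [_ [L6 L62]] f6; exists j.+1; split; first by rewrite addSnnS.
      + by case: env5 => *; split; rewrite f6.
      + by rewrite L6 L62 cats0 take_marking // rev_rcons [j == k]ltn_eqF.
      + by case: n5 => *; split; rewrite f6.
      + by rewrite f6.
    rewrite size_rev size_takel ?size_marking 1?ltnW //.
    by move: lt_jk; clear; set T := tROW _; lia.
  - move=> s1 [j [jk env2 [_ L3] _ I1E]].
    rewrite addn0 in jk; apply: some_run_empty; last by rewrite I1E.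
    by rewrite L3 jk drop_oversize // size_marking.
by rewrite /tROWS; clear; set T := tROW _; nia.
Qed.

End Correctness.

(** The first coordinate must be 1. The number of letters and the certificate are
    guessed; all the remaining coordinates must be those of the word that the
    certificate writes. *)
Definition MAIN : program :=
  Pop rI (bit true) ;; Pop rI stop ;;
  Star (Push rL (mark (false, false))) ;;
  Star (any (fun x => any (fun y => Push rZ (mark (x, y))))) ;;
  ROWS ;; @Empty 11 sym rI.

Definition main_store (x : seq (option bool)) : memory :=
  @input_store (option bool) (bool * bool)%type 11 x.

(** The word is read off the certificate that was guessed: as each pass interprets it in the
    same way, all the coordinates belong to one and the same word. *)
Lemma all_runs_MAIN x : all_runs MAIN (main_store x)
  (fun _ => exists k w, all (gtn k) w /\ x = enc k w).
Proof.
pose emp (s : memory) (rs : seq register) := forall r, r \notin rs -> s r = [::].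
apply: all_runs_seq; apply: all_runs_pop => l lE; apply: all_runs_seq;
  apply: all_runs_pop => l' lE'.
rewrite {1}/upd /= in lE'; set s0 := upd _ _ _.
have e0 : emp s0 [:: rI].
  by move=> r; rewrite inE /s0 /upd /main_store /input_store => /negbTE->.
have xE : input x = bit true :: stop :: s0 rI by rewrite -lE'.
apply: all_runs_seq; apply: (@all_runs_star _ _ (fun s1 => [/\ s1 rI = s0 rI, emp s1 [:: rI; rL] &
    exists k, s1 rL = nseq k (mark (false, false))])).
- split=> //; last by exists 0; rewrite /= e0.
  by move=> r; rewrite !inE negb_or => /andP[rI1 _]; rewrite e0 // inE.
- move=> s1 [I1 e1 [k L1]]; apply: all_runs_push; split=> //.
    by move=> r rE; rewrite -(e1 _ rE) /upd; move: rE; rewrite !inE negb_or => /andP[_ /negbTE->].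
  by exists k.+1; rewrite /upd /= L1.
move=> s1 [I1 e1 [k L1]].
apply: all_runs_seq; apply: (@all_runs_star _ _ (fun s2 => [/\ s2 rI = s0 rI,
   emp s2 [:: rI; rL; rZ], s2 rL = s1 rL & exists z, s2 rZ = marks z])).
- split=> //; last by exists [::]; rewrite e1.
  by move=> r; rewrite !inE !negb_or => /and3P[rI1 rL1 _]; rewrite e1 // !inE negb_or rI1.
- move=> s2 [I2 e2 L2 [z Z2]]; apply: all_runs_any => x1; apply: all_runs_any => y1.
  apply: all_runs_push; split=> //.
    move=> r rE; rewrite -(e2 _ rE) /upd; move: rE.
    by rewrite !inE !negb_or => /and3P[_ _ /negbTE->].
  by exists ((x1, y1) :: z); rewrite /upd /= Z2.
move=> s2 [I2 e2 L2 [z Z2]].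
have L2E : s2 rL = marks (marking k 0 k) by rewrite L2 L1 marking_none /marks map_nseq.
have env2 : pass_ready z s2 by split; rewrite // e2.
apply: all_runs_seq; apply: (all_runs_mono (all_runs_ROWS env2 L2E _)) => [|s3 I3];
  first by rewrite e2.
apply: all_runs_empty => I30; exists k, (foldl (istep k) start_istate z).1.1.
split; first exact: foldl_letters.
have inj : injective input by apply: inj_map => a b [].
apply: inj; rewrite xE -I2 I3 I30 cats0 /enc input_cat input_number_code.
by rewrite binary_rec.
Qed.

Definition tMAIN k n : nat := tROWS k n + 10 * k + 10 * n + 100.

Lemma some_run_MAIN k w z : valid k start_istate z ->
  (forall a b, a <= k -> b < k -> pairs a b (foldl (istep k) start_istate z).1.1 = pairs a b w) ->
  some_run (tMAIN k (size z)) MAIN (main_store (enc k w)) (fun _ => True).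
Proof.
move=> vz pairsE; set w' := _.1.1 in pairsE.
have encE : enc k w = enc k w'.
  congr (_ ++ flatten _); apply/eq_in_map => a; rewrite mem_iota ltnS => /= ak.
  by congr flatten; apply/eq_in_map => b; rewrite mem_iota => /= bk; rewrite pairsE.
pose emp (s : memory) (rs : seq register) := forall r, r \notin rs -> s r = [::].
have xE : input (enc k w) = [:: bit true, stop & input (rows k z 0 k.+1)].
  by rewrite encE /enc input_cat input_number_code binary_rec.
eapply some_run_le.
  apply: some_run_seq; apply: some_run_pop; first by rewrite /main_store /input_store eqxx;
    exact: xE.
  apply: some_run_seq; apply: some_run_pop; first by [].
  set s0 := upd _ _ _.
  have e0 : emp s0 [:: rI].
    by move=> r; rewrite inE /s0 /upd /main_store /input_store => /negbTE->.
  apply: some_run_seq.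
  pose I1 m (s1 : memory) := [/\ s1 rI = s0 rI, emp s1 [:: rI; rL] &
    s1 rL = nseq (k - m) (mark (false, false))].
  apply: (some_run_mono (@some_run_loop _ _ I1 2 _ _ k _ _)) => //.
  - split=> //; last by rewrite subnn e0.
    by move=> r; rewrite !inE negb_or => /andP[rI1 _]; rewrite e0 // inE.
  - move=> m s1 mk_ [E1 e1 L1]; apply: some_run_push; split=> //.
      by move=> r rE; rewrite -(e1 _ rE) /upd; move: rE;
        rewrite !inE negb_or => /andP[_ /negbTE->].
    by rewrite /upd /= L1 -(subnSK mk_).
  move=> s1 [E1 e1]; rewrite subn0 => L1; apply: some_run_seq.
  pose I2 m (s2 : memory) := [/\ s2 rI = s0 rI, emp s2 [:: rI; rL; rZ], s2 rL = s1 rL &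
    s2 rZ = marks (drop m z)].
  apply: (some_run_mono (@some_run_loop _ _ I2 4 _ _ (size z) _ _)) => //.
  - split=> //; last by rewrite drop_size e1.
    by move=> r; rewrite !inE !negb_or => /and3P[rI1 rL1 _]; rewrite e1 // !inE negb_or rI1.
  - move=> m s2 mz [E2 e2 L2 Z2]; case mE : (nth (false, false) z m) => [x y].
    apply: (@some_run_any _ _ 3 x); apply: (@some_run_any _ _ 2 y); apply: some_run_push;
      split=> //.
      move=> r rE; rewrite -(e2 _ rE) /upd; move: rE.
      by rewrite !inE !negb_or => /and3P[_ _ /negbTE->].
    by rewrite /upd /= Z2 [drop m z](drop_nth (false, false)) // mE.
  move=> s2 [E2 e2 L2]; rewrite drop0 => Z2.
  have L2E : s2 rL = marks (marking k 0 k) by rewrite L2 L1 marking_none /marks map_nseq.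
  have env2 : pass_ready z s2 by split; rewrite // e2.
  have nn : bit_stacks (4 * size z + 8) s2 by split; rewrite e2.
  have L22 : s2 rL2 = [::] by rewrite e2.
  apply: some_run_seq.
  apply: (some_run_mono (some_run_ROWS (l := [::]) env2 L2E L22 nn vz _)) => //.
    by rewrite cats0 E2.
  by move=> s3 I3; apply: some_run_empty.
by rewrite /tMAIN; clear; set T := tROWS _ _; lia.
Qed.

(** * Polynomial time *)

Lemma size_flatten_mem (T : eqType) (ss : seq (seq T)) s :
  s \in ss -> size s <= size (flatten ss).
Proof.
elim: ss => //= s1 ss IH; rewrite inE size_cat => /predU1P[->|/IH]; first exact: leq_addr.
by move/leq_trans; apply; exact: leq_addl.
Qed.

Lemma size_enc_row k w a : k <= size (enc_row k w a).
Proof.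
rewrite /enc_row -[X in X <= _](size_iota 0); elim: (iota 0 k) => //= b s IH.
by rewrite size_cat size_rcons addSn ltnS (leq_trans IH) // leq_addl.
Qed.

Lemma size_row0 k w : size (enc_row k w 0) <= size (enc k w).
Proof. by rewrite /enc /= !size_cat; lia. Qed.

(** The length of each numeral in row 0 bounds the number of occurrences of a letter,
    so the exponents of the runs have at most linearly many digits. *)
Lemma size_word_enc k w : all (gtn k) w -> size w < 2 ^ (size (enc k w) + k).
Proof.
move=> wk; rewrite -(sum_count_letters wk).
apply: (@leq_ltn_trans (k * 2 ^ size (enc k w))); last first.
  by rewrite addnC expnD ltn_pmul2r ?expn_gt0 // ltn_expl.
rewrite -[X in X * _](card_ord k) -sum_nat_const; apply: leq_sum => b _.
rewrite -pairs0; apply: ltnW; apply: leq_trans (ltn_binary _) _.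
rewrite leq_exp2l //; apply: leq_trans _ (size_row0 k w).
have mem_b : number_code (pairs 0 b w) \in [seq number_code (pairs 0 b w) | b <- iota 0 k].
  by apply: (map_f (fun b => number_code (pairs 0 b w))); rewrite mem_iota ltn_ord.
by apply: leq_trans _ (size_flatten_mem mem_b); rewrite size_rcons (size_map Some).
Qed.

Lemma tMAIN_mono k k' n n' : k <= k' -> n <= n' -> tMAIN k n <= tMAIN k' n'.
Proof.
move=> kk nn; rewrite /tMAIN /tROWS /tROW /tPASS.
by repeat match goal with
| |- is_true (?a <= ?a) => exact: leqnn
| |- is_true (_ + _ <= _ + _) => apply: leq_add
| |- is_true (_ * _ <= _ * _) => apply: leq_mul
| _ => assumption
end.
Qed.

Definition polyfun (f : nat -> nat) := exists p : {poly nat}, forall n, p.[n]%R = f n.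

Lemma polyfun_const c : polyfun (fun _ => c).
Proof. by exists (c%:P)%R => n; rewrite hornerC. Qed.

Lemma polyfun_id : polyfun id.
Proof. by exists 'X%R => n; rewrite hornerX. Qed.

Lemma polyfun_add f g : polyfun f -> polyfun g -> polyfun (fun n => f n + g n).
Proof. by move=> [p pE] [q qE]; exists (p + q)%R => n; rewrite hornerD pE qE. Qed.

Lemma polyfun_mul f g : polyfun f -> polyfun g -> polyfun (fun n => f n * g n).
Proof. by move=> [p pE] [q qE]; exists (p * q)%R => n; rewrite hornerM pE qE. Qed.

Lemma polyfun_succ f : polyfun f -> polyfun (fun n => (f n).+1).
Proof.
by move=> /polyfun_add /(_ (polyfun_const 1))[p pE]; exists p => n; rewrite pE addn1.
Qed.

(** The bound of [exists_cert] for [k = N] and [e = N + N], where [N] is the size of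
    the input: there are at most [N] letters, and [size_word_enc] bounds [e]. *)
Definition cert_size N := N * (8 * (N + (N + N)).+1 ^ 2) * (1 + N + (N + N) * (N + N)).

Lemma polyfun_time : polyfun (fun N => tMAIN N (cert_size N)).
Proof.
rewrite /tMAIN /tROWS /tROW /tPASS /cert_size.
by repeat match goal with
| |- polyfun (fun _ => ?c) => exact: polyfun_const
| |- polyfun (fun n => n) => exact: polyfun_id
| |- polyfun (fun n => @?f n + @?g n) => apply: (@polyfun_add f g)
| |- polyfun (fun n => @?f n * @?g n) => apply: (@polyfun_mul f g)
| |- polyfun (fun n => @?f n ^ 2) => apply: (@polyfun_mul f f)
| |- polyfun (fun n => (@?f n).+1) => apply: (@polyfun_succ f)
end.
Qed.

Theorem proposition4p2 : NP binary_2_realization.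
Proof.
have [p pE] := polyfun_time; exists (machine MAIN), p.
have fast x : binary_2_realization x -> exists2 n, n <= p.[size x]%R &
    accepts_in (machine MAIN) x n.
  move=> /binary_2_realizationP[k [w [wk ->]]]; set N := size _.
  have kN : k <= N := leq_trans (size_enc_row k w 0) (size_row0 k w).
  have [z [vz sz pairsE]] := exists_cert wk (size_word_enc wk).
  have [s [n [nt e _]]] := some_run_MAIN vz pairsE.
  exists n; last exact: exec_accepts_in e.
  rewrite pE; apply: leq_trans nt _; apply: tMAIN_mono => //.
  apply: leq_trans sz _; rewrite -/N /cert_size.
  have eN : N + k <= N + N by rewrite leq_add2l.
  have qN : (k + (N + k)).+1 <= (N + (N + N)).+1 by rewrite ltnS leq_add.
  by rewrite !leq_mul ?leq_add ?leq_sqr ?leq_mul.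
split=> // x; split=> [/fast[n _ xn]|/accepts_exec[s [n e]]]; first by exists n.
exact/binary_2_realizationP/(all_runs_MAIN e).
Qed.
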